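(* Let $\Omega\subset\mathbb{R}^n$ be an open set with nonempty boundary and let $0<q<2$. Let $f,g:\mathbb{R}\to\mathbb{R}$ be nondecreasing continuous functions such that $f(-t)<0<f(t)$ for all $t>0$, at least one of $f$, $g$ is strictly increasing, and $g(t)\ge0$ for all $t>0$. Assume $$\int_1^\infty\frac{ds}{\sqrt{F(s)}+G(s)^{\frac1{2-q}}}<\infty,\qquad F(t):=\int_0^tf(s)\,ds,\quad G(t):=\int_0^tg(s)\,ds,$$ and, if $1<q<2$, assume also that $\lim_{t\to\infty}f(t)=\infty$ or $\lim_{t\to\infty}g(t)=\infty$. Suppose further that the function $$h(s):=\left(\frac{f(s)}{s}\right)^{1/2}+\left(\frac{g(s)}{s^{1-q}}\right)^{1/(2-q)},\qquad s>0,$$ satisfies, for some constant $0<\mu<1$, $h(s)\ge\mu\,h(t)$ for all $s\ge t>0$. Then $\Psi(0+)=\infty$, and every viscosity subsolution $u\in\mathrm{USC}(\Omega)$ of $$\Delta_\infty^Nu=f(u)+g(u)|Du|^q\quad\text{in }\Omega$$ satisfies $$u(x)\le\Phi(d_\Omega(x))\qquad\text{for all }x\in\Omega.$$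
   Context: $d_\Omega(x)$ is the distance from $x$ to $\partial\Omega$; $\mathrm{USC}(\Omega)$ is the class of upper-semicontinuous real-valued functions on $\Omega$. Viscosity subsolutions: for $\phi$ of class $C^2$ near $x$, put $\Delta_\infty^{N,+}\phi(x):=|D\phi(x)|^{-2}\langle D^2\phi(x)D\phi(x),D\phi(x)\rangle$ if $D\phi(x)\ne0$, and $\Delta_\infty^{N,+}\phi(x):=\max\{\langle D^2\phi(x)e,e\rangle:|e|=1\}$ if $D\phi(x)=0$. A function $u\in\mathrm{USC}(\Omega)$ is a viscosity subsolution of the equation if, whenever $x_0\in\Omega$ and $\phi$ is $C^2$ near $x_0$ with $u-\phi$ having a local maximum at $x_0$, one has $\Delta_\infty^{N,+}\phi(x_0)\ge f(u(x_0))+g(u(x_0))|D\phi(x_0)|^q$. The constant $C(q)$: for $0<t<s$ write $\mathcal{F}(s,t):=F(s)-F(t)$ and $\mathcal{G}(s,t):=G(s)-G(t)$. For $a>0$ consider the initial-value problem $$\phi''(r)=f(\phi)+g(\phi)|\phi'|^q\ (r>0),\qquad \phi(0)=a,\ \phi'(0)=0.$$ $C(q)>0$ denotes a fixed constant depending only on $q$ such that, for all nondecreasing continuous $f,g$ with $f(-t)<0<f(t)$ and $g(t)\ge0$ for $t>0$ and at least one of $f,g$ strictly increasing, all $a>0$, and every solution $\phi\in C^2([0,R))$ of this problem, $$C(q)\left(\sqrt{\mathcal{F}(\phi(r),a)}+\mathcal{G}(\phi(r),a)^{\frac1{2-q}}\right)\le\phi'(r),\qquad 0<r<R.$$ The functions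 $\Psi,\Phi$: define $$\Psi(t):=\frac1{C(q)}\int_t^\infty\frac{ds}{\sqrt{\mathcal{F}(s,t)}+\mathcal{G}(s,t)^{\frac1{2-q}}},\qquad t>0.$$ Under the hypotheses of the claim other than the one on $h$, $\Psi$ is finite, continuous and strictly decreasing on $(0,\infty)$ with $\lim_{t\to\infty}\Psi(t)=0$. Put $\Psi(0+):=\lim_{t\to0^+}\Psi(t)\in(0,\infty]$, and let $\Phi:(0,\Psi(0+))\to(0,\infty)$ be the (decreasing) inverse of $\Psi$. *)

(* Defs.v *)
From mathcomp Require Export all_boot all_order all_algebra.
From mathcomp Require Export all_classical all_reals all_analysis.
Export Order.TTheory GRing.Theory Num.Theory numFieldNormedType.Exports.

Set Implicit Arguments.
Unset Strict Implicit.
Unset Printing Implicit Defensive.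

Local Open Scope classical_set_scope.
Local Open Scope ring_scope.

(* The library norm on ['rV[R]_n] is the sup norm; it induces the usual
   topology, but lengths and distances have to be the Euclidean ones below. *)
Definition dotp (R : realType) (n : nat) (x y : 'rV[R]_n) : R :=
  \sum_(i < n) x 0 i * y 0 i.

Definition enorm (R : realType) (n : nat) (x : 'rV[R]_n) : R :=
  Num.sqrt (dotp x x).

Definition boundary (T : topologicalType) (A : set T) : set T :=
  closure A `\` interior A.

Definition bdist (R : realType) (n : nat) (Omega : set 'rV[R]_n)
    (x : 'rV[R]_n) : R :=
  inf [set enorm (x - y) | y in boundary Omega].

(* [u] is a total function; only its values on [A] are constrained. *)
Definition usc_on (R : realType) (T : topologicalType) (A : set T)
    (u : T -> R) : Prop :=
  forall x, A x -> forall a, u x < a -> \forall y \near within A (nbhs x), u y < a.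

Definition partial (R : realType) (n : nat) (i : 'I_n) (phi : 'rV[R]_n -> R) :
    'rV[R]_n -> R :=
  'D_(delta_mx 0 i) phi.

Definition C2_near (R : realType) (n : nat) (phi : 'rV[R]_n -> R)
    (x : 'rV[R]_n) : Prop :=
  \forall y \near x,
    [/\ {for y, continuous phi},
        forall i, derivable phi y (delta_mx 0 i) /\
                  {for y, continuous (partial i phi)} &
        forall i j, derivable (partial i phi) y (delta_mx 0 j) /\
                    {for y, continuous (partial j (partial i phi))}].

Definition grad (R : realType) (n : nat) (phi : 'rV[R]_n -> R)
    (x : 'rV[R]_n) : 'rV[R]_n :=
  \row_i partial i phi x.

Definition hess (R : realType) (n : nat) (phi : 'rV[R]_n -> R)
    (x : 'rV[R]_n) : 'M[R]_n :=
  \matrix_(i, j) partial j (partial i phi) x.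

(* The supremum in the second case is a maximum: the unit sphere is compact,
   and nonempty for [0 < n]. *)
Definition inf_laplacian_plus (R : realType) (n : nat) (phi : 'rV[R]_n -> R)
    (x : 'rV[R]_n) : R :=
  let p := grad phi x in
  let H := hess phi x in
  if p == 0 then sup [set dotp (e *m H) e | e in [set e | enorm e = 1]]
  else (enorm p ^+ 2)^-1 * dotp (p *m H) p.

Definition viscosity_subsolution (R : realType) (n : nat) (q : R)
    (f g : R -> R) (Omega : set 'rV[R]_n) (u : 'rV[R]_n -> R) : Prop :=
  usc_on Omega u /\
  forall (x0 : 'rV[R]_n) (phi : 'rV[R]_n -> R),
    Omega x0 -> C2_near phi x0 ->
    (\forall y \near within Omega (nbhs x0), u y - phi y <= u x0 - phi x0) ->
    f (u x0) + g (u x0) * enorm (grad phi x0) `^ q <= inf_laplacian_plus phi x0.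

Definition primitive (R : realType) (f : R -> R) (t : R) : R :=
  if 0 <= t then \int[lebesgue_measure]_(s in `[0, t]) f s
  else - \int[lebesgue_measure]_(s in `[t, 0]) f s.

Definition admissible (R : realType) (f g : R -> R) : Prop :=
  [/\ continuous f /\ continuous g,
      {homo f : x y / x <= y} /\ {homo g : x y / x <= y},
      forall t, 0 < t -> f (- t) < 0 /\ 0 < f t,
      {homo f : x y / x < y} \/ {homo g : x y / x < y} &
      forall t, 0 < t -> 0 <= g t].

(* [sqrt (F(s) - F(t)) + (G(s) - G(t)) ^ (1 / (2 - q))] *)
Definition sqrtF_powG (R : realType) (q : R) (f g : R -> R) (s t : R) : R :=
  Num.sqrt (primitive f s - primitive f t) +
  (primitive g s - primitive g t) `^ (2 - q)^-1.

(* The derivative of [phi] at [x] relative to [D]: one-sided at an endpoint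
   of an interval [D], two-sided in its interior. *)
Definition has_deriv_in (R : realType) (D : set R) (phi : R -> R)
    (x l : R) : Prop :=
  (phi y - phi x) / (y - x) @[y --> within D x^'] --> l.

(* [phi] is of class C^2 on [0, T), with derivatives [phi1] and [phi2], and
   solves [phi'' = f(phi) + g(phi) |phi'|^q], [phi(0) = a], [phi'(0) = 0];
   [T] may be infinite. *)
Definition ivp_solution (R : realType) (q : R) (f g : R -> R) (a : R)
    (T : \bar R) (phi phi1 phi2 : R -> R) : Prop :=
  let I := [set r : R | 0 <= r /\ (r%:E < T)%E] in
  [/\ forall r, I r -> has_deriv_in I phi r (phi1 r),
      forall r, I r -> has_deriv_in I phi1 r (phi2 r),
      {within I, continuous phi2},
      forall r, I r -> 0 < r ->
        phi2 r = f (phi r) + g (phi r) * `|phi1 r| `^ q &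
      phi 0 = a /\ phi1 0 = 0].

(* The property characterizing the admissible values of the constant C(q). *)
Definition is_Cq (R : realType) (q C : R) : Prop :=
  0 < C /\
  forall (f g : R -> R), admissible f g ->
  forall (a : R) (T : \bar R) (phi phi1 phi2 : R -> R),
    0 < a -> (0 < T)%E -> ivp_solution q f g a T phi phi1 phi2 ->
    forall r, 0 < r -> (r%:E < T)%E ->
      C * sqrtF_powG q f g (phi r) a <= phi1 r.

Definition Psi (R : realType) (q C : R) (f g : R -> R) (t : R) : \bar R :=
  (C^-1%:E * \int[lebesgue_measure]_(s in `]t, +oo[)
               ((sqrtF_powG q f g s t)^-1)%:E)%E.

(* The inverse of [Psi] on its range, with junk value 0 outside of it. *)
Definition Phi (R : realType) (q C : R) (f g : R -> R) (r : R) : R :=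
  xget 0 [set t : R | 0 < t /\ Psi q C f g t = r%:E].

Definition hfun (R : realType) (q : R) (f g : R -> R) (s : R) : R :=
  (f s / s) `^ 2^-1 + (g s / s `^ (1 - q)) `^ (2 - q)^-1.

(* Main.v *)
From HB Require Import structures.
From mathcomp Require Import measurable_realfun lra ring.
Require Import Defs.

(** Write S(s, t) for the denominator in the definition of Psi ([sqrtF_powG]),
so that C Psi(t) is the integral of 1 / S(s, t) over s > t
([escape_integral]).

A solution phi of the initial-value problem with phi(0) = a satisfies C S(phi,
a) <= phi'; separating variables, it reaches every level within the time
Psi(a) ([lifetime_le_escape]). Hence, if Psi(a) < d(x), the radial function
phi(|y - x|) exceeds any prescribed level on the boundary of a ball around x
whose radius is less than d(x). An upper-semicontinuous u is bounded above on
such balls, so if u(x) > a then u minus the radial function has a positive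
maximum inside the ball, which the equation does not allow: f(u) and g(u) are
at least the values at phi, and the radial function satisfies the equation.
Thus u(x) <= a ([subsolution_le]). Strictness is obtained for free by solving
with lam^2 f instead of f, where lam < 1 is close to 1: this costs only a
factor 1 / lam in the lifetime, for which there is room since Psi(a) < d(x).

For the existence of phi, f and g are merely continuous, but the first-order
system for phi and phi' is monotone in both unknowns, so that the supremum of
its subsolutions is a solution ([cooperative_system]); it is truncated first,
and an energy estimate based on q < 2 shows that the truncation is inactive
([radial_profile]). The radial function is never differentiated in space: it
is touched from above by quadratic polynomials in |y - x|^2, which are smooth
also at the centre ([radial_touching]).

It remains to pass from all a with Psi(a) < d(x) to a = Phi(d(x)), for which
Psi has to be strictly decreasing with range (0, oo). After the substitution s
= t + sigma the integrand is strictly decreasing in t ([escape_lt]), and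
dominated convergence gives continuity and the limit 0 at infinity
([escape_surjective], [escape_to0]). The almost monotonicity of h bounds S(s,
t) by a multiple of s for s <= 1, so the integral diverges at t = 0
([escape_at0]). *)

Set Implicit Arguments.
Unset Strict Implicit.
Unset Printing Implicit Defensive.

Local Open Scope classical_set_scope.
Local Open Scope ring_scope.

(** * Primitives and mean value inequalities *)

Lemma is_derive_continuous (R : realType) (F : R -> R) (x l : R) :
  is_derive x 1 F l -> {for x, continuous F}.
Proof.
by move=> dF; apply/differentiable_continuous/derivable1_diffP; case: dF.
Qed.

Lemma MVT_closed (R : realType) (F dF : R -> R) (a b : R) : a <= b ->
  (forall x, a <= x <= b -> is_derive x 1 F (dF x)) ->
  exists2 c, a <= c <= b & F b - F a = dF c * (b - a).
Proof.
move=> ab dFE.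
have [|x xab|c cab E] := @MVT_segment R F dF a b ab.
- by move=> x; rewrite in_itv /= => /andP[/ltW ax /ltW xb]; apply/dFE/andP.
- apply: derivable_within_continuous => y.
  by rewrite in_itv /= => /dFE; case.
- by exists c => //; move: cab; rewrite in_itv.
Qed.

Lemma ge0_derive_le (R : realType) (F dF : R -> R) (a b : R) : a <= b ->
  (forall x, a <= x <= b -> is_derive x 1 F (dF x)) ->
  (forall x, a <= x <= b -> 0 <= dF x) -> F a <= F b.
Proof.
move=> ab dFE dF0; have [c cab E] := MVT_closed ab dFE.
by rewrite -subr_ge0 E mulr_ge0 ?dF0 // subr_ge0.
Qed.

Lemma continuous_integrable_itv (R : realType) (h : R -> R) (a b : R) :
  continuous h -> lebesgue_measure.-integrable `[a, b] (EFin \o h).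
Proof.
move=> ch; apply: continuous_compact_integrable; first exact: segment_compact.
exact: continuous_subspaceT.
Qed.

(** Starting the integral at a point below both 0 and y turns the two cases in
the definition of [primitive] into one formula, to which the fundamental
theorem of calculus applies also at 0. *)
Lemma primitive_from (R : realType) (h : R -> R) (B y : R) : continuous h ->
  0 <= B -> - B <= y ->
  primitive h y = \int[lebesgue_measure]_(s in `[- B, y]) h s
                  - \int[lebesgue_measure]_(s in `[- B, 0]) h s.
Proof.
move=> ch B0 By; rewrite /primitive; case: ifPn => [y0|]; last first.
  rewrite -ltNge => y0; have y0' := ltW y0.
  rewrite -[RHS]opprB Rintegral_itvB //; try by rewrite bnd_simp.
    rewrite Rintegral_itv_obnd_cbnd //.
    apply: integrableS (continuous_integrable_itv y 0 ch) => //.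
    exact: subset_itv_oc_cc.
  exact: continuous_integrable_itv.
rewrite Rintegral_itvB //; try by rewrite bnd_simp // lerNl oppr0.
  rewrite Rintegral_itv_obnd_cbnd //.
  apply: integrableS (continuous_integrable_itv 0 y ch) => //.
  exact: subset_itv_oc_cc.
exact: continuous_integrable_itv.
Qed.

Lemma primitive_is_derive (R : realType) (h : R -> R) (x : R) : continuous h ->
  is_derive x 1 (primitive h) (h x).
Proof.
move=> ch; (* The lower limit -B lies below 0 and strictly below x. *)
pose B := `|x| + 1.
have B0 : 0 <= B by rewrite addr_ge0.
have Bx : - B < x.
  by rewrite ltrNl; apply: le_lt_trans (ler_norm _) _; rewrite normrN ltrDl.
pose c := \int[lebesgue_measure]_(s in `[- B, 0]) h s.
pose G := fun y => \int[lebesgue_measure]_(s in `[- B, y]) h s.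
have [dG G1] := @continuous_FTC1_closed R h (- B) x (x + 1)
  ltac:(by rewrite ltrDl) (continuous_integrable_itv _ _ ch) Bx (ch x).
apply: (@near_eq_is_derive _ _ _ (G - cst c)).
  near=> y; rewrite (@primitive_from _ _ B) //.
  by apply: ltW; near: y; exact: lt_nbhsr.
have dG' : is_derive x 1 G (h x).
  by apply: (@DeriveDef _ _ _ _ _ _ _ dG); rewrite -derive1E; exact: G1.
by apply: is_derive_eq; rewrite subr0.
Unshelve. all: by end_near. Qed.

Lemma primitive0 (R : realType) (h : R -> R) : primitive h 0 = 0.
Proof. by rewrite /primitive lexx set_itv1 Rintegral_set1. Qed.

Lemma primitive_continuous (R : realType) (h : R -> R) : continuous h ->
  continuous (primitive h).
Proof. by move=> ch x; exact: is_derive_continuous (primitive_is_derive x ch). Qed.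

Lemma primitive_itv (R : realType) (h : R -> R) (a b : R) : continuous h ->
  a <= b -> (\int[lebesgue_measure]_(s in `[a, b]) (h s)%:E
             = (primitive h b - primitive h a)%:E)%E.
Proof.
move=> ch ab; pose B := `|a|.
have Ba : - B <= a by rewrite lerNl (le_trans (ler_norm _)) // normrN.
have B0 : 0 <= B by exact: normr_ge0.
rewrite !(@primitive_from _ _ B) //; last exact: le_trans ab.
rewrite opprB addrA subrK.
rewrite Rintegral_itvB //; try by rewrite bnd_simp.
  rewrite Rintegral_itv_obnd_cbnd //.
    rewrite /Rintegral fineK //; apply: integrable_fin_num => //.
    exact: continuous_integrable_itv.
  apply: integrableS (continuous_integrable_itv a b ch) => //.
  exact: subset_itv_oc_cc.
exact: continuous_integrable_itv.
Qed.

Lemma primitive_mono (R : realType) (h k : R -> R) (a b : R) :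
  continuous h -> continuous k -> a <= b ->
  (forall x, a <= x <= b -> h x <= k x) ->
  primitive h b - primitive h a <= primitive k b - primitive k a.
Proof.
move=> ch ck ab hk.
have d (x : R) : is_derive x 1 (primitive k - primitive h) (k x - h x).
  by apply: is_deriveB; exact: primitive_is_derive.
have := @ge0_derive_le R (primitive k - primitive h) (fun x => k x - h x) a b ab
   (fun x _ => d x) (fun x X => ltac:(rewrite subr_ge0; exact: hk X)).
by rewrite !fctE; lra.
Qed.

Lemma primitive_cst (R : realType) (c x : R) : primitive (cst c) x = c * x.
Proof.
have d (y : R) : is_derive y 1 (primitive (cst c) - (fun z => c * z)) 0.
  have := @primitive_is_derive R (cst c) y (@cst_continuous _ _ _) => ?.
  by apply: is_derive_eq; rewrite /= /GRing.scale /=; ring.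
have := is_derive_0_is_cst x 0 (fun y => d y).
by rewrite !fctE primitive0 mulr0 subr0 => /subr0_eq.
Qed.

Lemma primitive_le (R : realType) (h : R -> R) (a b c : R) :
  continuous h -> a <= b -> (forall x, a <= x <= b -> h x <= c) ->
  primitive h b - primitive h a <= c * (b - a).
Proof.
move=> ch ab hc; rewrite mulrBr -!primitive_cst.
by apply: primitive_mono => //; exact: cst_continuous.
Qed.

Lemma primitive_ge (R : realType) (h : R -> R) (a b c : R) :
  continuous h -> a <= b -> (forall x, a <= x <= b -> c <= h x) ->
  c * (b - a) <= primitive h b - primitive h a.
Proof.
move=> ch ab hc; rewrite mulrBr -!primitive_cst.
by apply: primitive_mono => //; exact: cst_continuous.
Qed.

Lemma primitive_scale (R : realType) (h : R -> R) (c x : R) : continuous h ->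
  primitive (fun t => c * h t) x = c * primitive h x.
Proof.
move=> ch.
have cch : continuous (fun t => c * h t) by move=> t; apply: cvgMr; exact: ch.
have d (y : R) : is_derive y 1 (primitive (fun t => c * h t) - c \*: primitive h) 0.
  have := primitive_is_derive y ch => ?; have := primitive_is_derive y cch => ?.
  by apply: is_derive_eq; rewrite /= /GRing.scale /=; ring.
have := is_derive_0_is_cst x 0 (fun y => d y).
by rewrite !fctE /= !primitive0 scaler0 subr0 => /subr0_eq.
Qed.

(** * Existence for monotone systems *)

Definition slowly_increasing (R : realType) (L : R) (x : R -> R) : Prop :=
  forall r s, r <= s -> x r <= x s <= x r + L * (s - r).

Lemma slowly_increasing_continuous (R : realType) (L : R) (x : R -> R) :
  0 <= L -> slowly_increasing L x -> continuous x.
Proof.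
move=> L0 sx r; apply/cvgrPdist_le => e e0.
have L1 : 0 < L + 1 by lra.
near=> t.
have rt : `|r - t| <= e / (L + 1).
  by near: t; apply: cvgr_dist_le => //; rewrite divr_gt0.
have : (L + 1) * `|r - t| <= e by rewrite mulrC -ler_pdivlMr.
apply: le_trans; case: (leP r t) => [rt'|/ltW rt'].
  rewrite (distrC r) (ger0_norm (_ : 0 <= t - r)) ?subr_ge0 //.
  have /andP[h1 h2] := sx _ _ rt'.
  by rewrite distrC ger0_norm ?subr_ge0 // mulrDl; lra.
rewrite (ger0_norm (_ : 0 <= r - t)) ?subr_ge0 //.
have /andP[h1 h2] := sx _ _ rt'.
by rewrite ger0_norm ?subr_ge0 // mulrDl; lra.
Unshelve. all: by end_near. Qed.

(** The nonlinearities need not be Lipschitz, but they are nondecreasing in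
both unknowns, so the integral operator of the initial-value problem is
monotone. The pairs of nondecreasing L-Lipschitz functions that lie below
their image are stable under this operator and under pointwise suprema; the
supremum of all of them is therefore a fixed point, as in the Knaster-Tarski
theorem. Being Lipschitz, it is continuous, and no limit of integrals has to
be taken. *)
Lemma cooperative_system (R : realType) (x0 L : R) (H1 H2 : R -> R -> R) :
  (forall x y, 0 <= H1 x y <= L) -> (forall x y, 0 <= H2 x y <= L) ->
  (forall x x' y y', x <= x' -> y <= y' -> H1 x y <= H1 x' y') ->
  (forall x x' y y', x <= x' -> y <= y' -> H2 x y <= H2 x' y') ->
  (forall x y : R -> R, continuous x -> continuous y ->
     continuous (fun r => H1 (x r) (y r))) ->
  (forall x y : R -> R, continuous x -> continuous y ->
     continuous (fun r => H2 (x r) (y r))) ->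
  exists x y : R -> R, [/\ continuous x, continuous y,
    forall r, 0 <= r -> x r = x0 + primitive (fun s => H1 (x s) (y s)) r &
    forall r, 0 <= r -> y r = primitive (fun s => H2 (x s) (y s)) r].
Proof.
move=> B1 B2 M1 M2 C1 C2.
have L0 : 0 <= L by have /andP[] := B1 0 0; exact: le_trans.
pose op (H : R -> R -> R) c (x y : R -> R) r :=
  c + primitive (fun s => H (x s) (y s)) (Num.max r 0).
have op_slow H c x y : (forall x y, 0 <= H x y <= L) ->
    continuous (fun r => H (x r) (y r)) -> slowly_increasing L (op H c x y).
  move=> BH cH r s rs; rewrite /op.
  have rs' : Num.max r 0 <= Num.max s 0 by rewrite ge_max !le_max rs lexx orbT.
  have rs2 : Num.max s 0 - Num.max r 0 <= s - r.
    by rewrite /Order.max; case: ifP; case: ifP; lra.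
  have P1 := @primitive_ge _ _ _ _ 0 cH rs'
    (fun z _ => ltac:(by case/andP: (BH (x z) (y z)))).
  have P2 := @primitive_le _ _ _ _ L cH rs'
    (fun z _ => ltac:(by case/andP: (BH (x z) (y z)))).
  have P3 : L * (Num.max s 0 - Num.max r 0) <= L * (s - r) by rewrite ler_wpM2l.
  by apply/andP; split; lra.
have op_le H c x y x' y' :
    (forall x x' y y', x <= x' -> y <= y' -> H x y <= H x' y') ->
    continuous (fun r => H (x r) (y r)) ->
    continuous (fun r => H (x' r) (y' r)) ->
    (forall r, x r <= x' r) -> (forall r, y r <= y' r) ->
    forall r, op H c x y r <= op H c x' y' r.
  move=> MH cH cH' xx yy r; rewrite /op lerD2l.
  have r0 : 0 <= Num.max r 0 by rewrite le_max lexx orbT.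
  have := primitive_mono cH cH' r0 (fun z _ => MH _ _ _ _ (xx z) (yy z)).
  by rewrite !primitive0 !subr0.
have op_ub H c x y : (forall x y, 0 <= H x y <= L) ->
    continuous (fun r => H (x r) (y r)) ->
    forall r, op H c x y r <= c + L * Num.max r 0.
  move=> BH cH r; rewrite /op lerD2l.
  have r0 : 0 <= Num.max r 0 by rewrite le_max lexx orbT.
  have := @primitive_le _ _ _ _ L cH r0
    (fun z _ => ltac:(by case/andP: (BH (x z) (y z)))).
  by rewrite primitive0 !subr0.
have op_lb H c x y : (forall x y, 0 <= H x y <= L) ->
    continuous (fun r => H (x r) (y r)) -> forall r, c <= op H c x y r.
  move=> BH cH r; rewrite /op lerDl.
  have r0 : 0 <= Num.max r 0 by rewrite le_max lexx orbT.
  have := @primitive_ge _ _ _ _ 0 cH r0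
    (fun z _ => ltac:(by case/andP: (BH (x z) (y z)))).
  by rewrite primitive0 !subr0 mul0r.
(* The subsolutions; their supremum (X, Y) is the solution. *)
pose sub (p : (R -> R) * (R -> R)) :=
  [/\ slowly_increasing L p.1, slowly_increasing L p.2,
      forall r, p.1 r <= op H1 x0 p.1 p.2 r &
      forall r, p.2 r <= op H2 0 p.1 p.2 r].
have ccst (c : R) : continuous (cst c : R -> R) by exact: cst_continuous.
have cst_slow (c : R) : slowly_increasing L (cst c).
  by move=> r s rs /=; rewrite lexx lerDl mulr_ge0 // subr_ge0.
have sub0 : sub (cst x0, cst 0).
  split=> //= r.
  - by apply: op_lb => //; exact: (C1 (cst x0) (cst 0)).
  - by apply: op_lb => //; exact: (C2 (cst x0) (cst 0)).
pose X r := sup [set p.1 r | p in sub].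
pose Y r := sup [set p.2 r | p in sub].
have subX p r : sub p -> p.1 r <= X r.
  move=> sp; apply: ub_le_sup; last by exists p.
  exists (x0 + L * Num.max r 0) => _ [p' [s1 s2 l1 l2] <-].
  apply: (le_trans (l1 r)); apply: op_ub => //.
  by apply: C1; exact: (slowly_increasing_continuous L0).
have subY p r : sub p -> p.2 r <= Y r.
  move=> sp; apply: ub_le_sup; last by exists p.
  exists (0 + L * Num.max r 0) => _ [p' [s1 s2 l1 l2] <-].
  apply: (le_trans (l2 r)); apply: op_ub => //.
  by apply: C2; exact: (slowly_increasing_continuous L0).
have Xle r c : (forall p, sub p -> p.1 r <= c) -> X r <= c.
  move=> h; apply: ge_sup; first by exists x0, (cst x0, cst 0).
  by move=> _ [p sp <-]; exact: h.
have Yle r c : (forall p, sub p -> p.2 r <= c) -> Y r <= c.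
  move=> h; apply: ge_sup; first by exists 0, (cst x0, cst 0).
  by move=> _ [p sp <-]; exact: h.
have slowX : slowly_increasing L X.
  move=> r s rs; apply/andP; split.
    apply: Xle => p sp; apply: le_trans (subX _ s sp).
    by case: (sp) => /(_ _ _ rs)/andP[].
  apply: Xle => p sp; case: (sp) => /(_ _ _ rs)/andP[_ h] _ _ _.
  by apply: (le_trans h); rewrite lerD2r; exact: subX.
have slowY : slowly_increasing L Y.
  move=> r s rs; apply/andP; split.
    apply: Yle => p sp; apply: le_trans (subY _ s sp).
    by case: (sp) => _ /(_ _ _ rs)/andP[].
  apply: Yle => p sp; case: (sp) => _ /(_ _ _ rs)/andP[_ h] _ _.
  by apply: (le_trans h); rewrite lerD2r; exact: subY.
have cX := slowly_increasing_continuous L0 slowX.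
have cY := slowly_increasing_continuous L0 slowY.
have leX r : X r <= op H1 x0 X Y r.
  apply: Xle => p sp; case: (sp) => s1 s2 l1 l2; apply: (le_trans (l1 r)).
  apply: op_le => //.
  - by apply: C1; exact: (slowly_increasing_continuous L0).
  - exact: C1.
  - by move=> z; exact: subX.
  - by move=> z; exact: subY.
have leY r : Y r <= op H2 0 X Y r.
  apply: Yle => p sp; case: (sp) => s1 s2 l1 l2; apply: (le_trans (l2 r)).
  apply: op_le => //.
  - by apply: C2; exact: (slowly_increasing_continuous L0).
  - exact: C2.
  - by move=> z; exact: subX.
  - by move=> z; exact: subY.
have cX' : continuous (op H1 x0 X Y).
  by apply: (slowly_increasing_continuous L0); apply: op_slow => //; exact: C1.
have cY' : continuous (op H2 0 X Y).
  by apply: (slowly_increasing_continuous L0); apply: op_slow => //; exact: C2.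
have subXY : sub (op H1 x0 X Y, op H2 0 X Y).
  split=> //=.
  - by apply: op_slow => //; exact: C1.
  - by apply: op_slow => //; exact: C2.
  - by apply: op_le => //; [exact: C1|exact: C1].
  - by apply: op_le => //; [exact: C2|exact: C2].
exists X, Y; split=> // r r0.
- have := subX _ r subXY => /= h.
  have /eqP -> : X r == op H1 x0 X Y r by rewrite eq_le leX h.
  by rewrite /op max_l.
- have := subY _ r subXY => /= h.
  have /eqP -> : Y r == op H2 0 X Y r by rewrite eq_le leY h.
  by rewrite /op add0r max_l.
Qed.

(** * Radial solutions reaching a given level *)

Lemma le_powR (R : realType) (q x y : R) : 0 < q -> 0 <= x -> x <= y ->
  x `^ q <= y `^ q.
Proof.
move=> q0 x0 xy; apply: ge0_ler_powR => //; first exact: ltW.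
by rewrite nnegrE (le_trans x0).
Qed.

(** The real power takes the value 1 at negative bases, so it has to be cut
off below 0 to be continuous. *)
Lemma continuous_pos_powR (R : realType) (q : R) : 0 < q ->
  continuous (fun x : R => Num.max x 0 `^ q).
Proof.
move=> q0 x; have [x0|x0] := ltP 0 x.
  have c : {for x, continuous (fun y : R => y `^ q)}.
    apply/differentiable_continuous/derivable1_diffP/derivable_powR.
    by rewrite in_itv /= x0.
  rewrite /continuous_at max_l ?(ltW x0) //.
  apply: cvg_trans c; apply: near_eq_cvg; near=> y.
  by rewrite max_l //; apply: ltW; near: y; exact: lt_nbhsr.
rewrite /continuous_at max_r // powR0 ?gt_eqF //.
apply/cvgrPdist_le => e e0; near=> t.
rewrite sub0r normrN ger0_norm ?powR_ge0 //.
have ee : (e `^ q^-1) `^ q = e.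
  by rewrite -powRrM mulVf ?gt_eqF // powRr1 // ltW.
rewrite -{1}ee; apply: le_powR => //; first by rewrite le_max lexx orbT.
rewrite ge_max powR_ge0 andbT; apply: ltW; near: t; apply: lt_nbhsl.
by apply: le_lt_trans x0 _; rewrite powR_gt0.
Unshelve. all: by end_near. Qed.

Lemma continuous_maxr (R : realType) (h : R -> R) (c : R) : continuous h ->
  continuous (fun x => Num.max (h x) c).
Proof.
by move=> ch x; apply: (@continuous_max R _ h (cst c)); [exact: ch|exact: cst_continuous].
Qed.

Lemma continuous_minr (R : realType) (h : R -> R) (c : R) : continuous h ->
  continuous (fun x => Num.min (h x) c).
Proof.
by move=> ch x; apply: (@continuous_min R _ h (cst c)); [exact: ch|exact: cst_continuous].
Qed.

Lemma IVT_le (R : realType) (h : R -> R) (a b v : R) : a <= b ->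
  continuous h -> h a <= v <= h b -> exists2 c, a <= c <= b & h c = v.
Proof.
move=> ab ch /andP[av vb].
have := @IVT R h a b v ab (continuous_subspaceT ch).
rewrite ge_min le_max av vb orbT => /(_ isT)[c]; rewrite in_itv /=.
by exists c.
Qed.

(** Here the growth condition q < 2 enters. *)
Lemma subquadratic_bound (R : realType) (q alpha beta : R) : 0 < q < 2 ->
  0 <= alpha -> 0 <= beta ->
  exists2 K, 1 <= K & alpha + beta * K `^ q < K ^+ 2 / 2.
Proof.
move=> /andP[q0 q2] a0 b0; have q2' : 0 < 2 - q by rewrite subr_gt0.
have e1 (p : R) : 1 `^ p = 1 by rewrite powR1.
pose c := 1 + 2 * (alpha + beta).
have c1 : 1 <= c by rewrite /c; lra.
have c0 : 0 < c by lra.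
pose K := c `^ (2 - q)^-1; have K0 : 0 < K by rewrite powR_gt0.
have Kc : K `^ (2 - q) = c.
  by rewrite /K -powRrM mulVf ?gt_eqF // powRr1 // ltW.
have K2 : K ^+ 2 = K `^ q * c.
  rewrite -Kc -powRD; last by apply/implyP => _; rewrite gt_eqF.
  by rewrite addrC subrK powR_mulrn // ltW.
have K1 : 1 <= K.
  by rewrite -[X in X <= _](e1 (2 - q)^-1); apply: le_powR => //; rewrite invr_gt0.
have Kq : 1 <= K `^ q.
  by rewrite -[X in X <= _](e1 q); apply: le_powR.
exists K => //; rewrite K2 /c; have : alpha <= alpha * K `^ q by rewrite ler_peMr.
lra.
Qed.

(** The initial-value problem has a solution that reaches any level M > a. In
the first-order system for phi and its slope, phi is truncated to [a, M] and
the slope to [0, K]: the truncated system is bounded and monotone. Multiplying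
the second equation by the slope bounds half its square by (M - a) times the
largest right-hand side, which is less than K^2 / 2 for a suitable K because q
< 2; so the truncation is inactive until phi = M. The functions are total, and
are extended to r < 0 as primitives, which makes all their derivatives
two-sided. *)
Lemma radial_profile (R : realType) (q a M : R) (f g : R -> R) :
  0 < q < 2 -> admissible f g -> 0 < a < M ->
  exists T (phi phi1 phi2 : R -> R),
    [/\ 0 < T /\ phi T = M, phi 0 = a /\ phi1 0 = 0,
      (forall r : R, is_derive r 1 phi (phi1 r)) /\
      (forall r : R, is_derive r 1 phi1 (phi2 r)),
      continuous phi2 /\
      (forall r, 0 <= r <= T -> phi2 r = f (phi r) + g (phi r) * phi1 r `^ q) &
      forall r, 0 <= r -> f a * r <= phi1 r].
Proof.
move=> hq [[cf cg] [mf mg] fpos _ gpos] /andP[a0 aM].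
have /andP[q0 q2] := hq.
have M0 : 0 < M by exact: lt_trans aM.
have fa : 0 < f a by case: (fpos a a0).
have fM : 0 < f M by case: (fpos M M0).
have gM : 0 <= g M by exact: gpos.
have Ma : 0 < M - a by rewrite subr_gt0.
have [K K1 HK] := @subquadratic_bound R q (f M * (M - a)) (g M * (M - a)) hq
  (mulr_ge0 (ltW fM) (ltW Ma)) (mulr_ge0 gM (ltW Ma)).
have K0 : 0 < K by lra.
pose cl x := Num.max (Num.min x M) a.
pose ck y := Num.max (Num.min y K) 0.
pose H1 (x y : R) := ck y.
pose H2 x y := f (cl x) + g (cl x) * ck y `^ q.
have cl_itv x : a <= cl x <= M.
  by rewrite /cl le_max lexx orbT ge_max ge_min lexx orbT ltW.
have ck_itv y : 0 <= ck y <= K.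
  by rewrite /ck le_max lexx orbT ge_max ge_min lexx orbT ltW.
have cl_id x : a <= x <= M -> cl x = x.
  by move=> /andP[ax xM]; rewrite /cl (min_l xM) (max_l ax).
have ck_id y : 0 <= y <= K -> ck y = y.
  by move=> /andP[ax xM]; rewrite /ck (min_l xM) (max_l ax).
have cl_mono x x' : x <= x' -> cl x <= cl x'.
  by move=> xx; rewrite /cl ge_max !le_max lexx orbT andbT le_min !ge_min xx lexx !orbT.
have ck_mono x x' : x <= x' -> ck x <= ck x'.
  by move=> xx; rewrite /ck ge_max !le_max lexx orbT andbT le_min !ge_min xx lexx !orbT.
have gcl x : 0 <= g (cl x).
  by apply: gpos; case/andP: (cl_itv x) => + _; exact: lt_le_trans.
pose Lk := f M + g M * K `^ q.
have H2lb x y : f a <= H2 x y.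
  rewrite /H2; have /andP[ax _] := cl_itv x.
  by rewrite -[f a]addr0 lerD ?mf ?mulr_ge0 ?powR_ge0.
have H2ub x y : H2 x y <= Lk.
  rewrite /H2; have /andP[_ xM] := cl_itv x; have /andP[y0 yK] := ck_itv y.
  apply: lerD; first exact: mf.
  apply: ler_pM; rewrite ?powR_ge0 ?mg //.
  exact: le_powR.
have Lk0 : 0 < Lk by rewrite (lt_le_trans _ (H2ub 0 0)) // (lt_le_trans fa).
have cH1 (x y : R -> R) : continuous x -> continuous y ->
    continuous (fun r => H1 (x r) (y r)).
  by move=> cx cy; apply: continuous_maxr; exact: continuous_minr.
have cH2 (x y : R -> R) : continuous x -> continuous y ->
    continuous (fun r => H2 (x r) (y r)).
  move=> cx cy.
  have ccl : continuous (cl \o x).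
    by apply: continuous_maxr; exact: continuous_minr.
  have cck : continuous (fun r => ck (y r) `^ q).
    move=> r; apply: (@continuous_comp _ _ _ (fun r => Num.min (y r) K)
      (fun y => Num.max y 0 `^ q)).
      exact: continuous_minr.
    exact: continuous_pos_powR.
  move=> r; apply: cvgD.
    by apply: (@continuous_comp _ _ _ (cl \o x) f); [exact: ccl|exact: cf].
  apply: cvgM; last exact: cck.
  by apply: (@continuous_comp _ _ _ (cl \o x) g); [exact: ccl|exact: cg].
have [X [Y [cX cY XE YE]]] : exists x y : R -> R, [/\ continuous x, continuous y,
    forall r, 0 <= r -> x r = a + primitive (fun s => H1 (x s) (y s)) r &
    forall r, 0 <= r -> y r = primitive (fun s => H2 (x s) (y s)) r].
  apply: (@cooperative_system R a (K + Lk) H1 H2).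
  - by move=> x y; have /andP[y0 yK] := ck_itv y; rewrite /H1 y0 /=; lra.
  - by move=> x y; have := H2lb x y; have := H2ub x y => *; apply/andP; split; lra.
  - by move=> x x' y y' _; exact: ck_mono.
  - move=> x x' y y' xx yy; apply: lerD; first exact/mf/cl_mono.
    apply: ler_pM; rewrite ?powR_ge0 ?mg ?cl_mono //.
    have /andP[y0 yK] := ck_itv y; have /andP[y'0 y'K] := ck_itv y'.
    by apply: le_powR => //; exact: ck_mono.
  - exact: cH1.
  - exact: cH2.
pose h1 s := H1 (X s) (Y s).
pose h2 s := H2 (X s) (Y s).
have ch1 : continuous h1 by exact: cH1.
have ch2 : continuous h2 by exact: cH2.
pose phi1 := primitive h2.
pose W r := a + primitive h1 r.
have XW r : 0 <= r -> X r = W r by exact: XE.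
have Yphi1 r : 0 <= r -> Y r = phi1 r by exact: YE.
have W_mono r s : r <= s -> W r <= W s.
  move=> rs; rewrite /W lerD2l -subr_ge0 -(mul0r (s - r)).
  by apply: primitive_ge => // z _; case/andP: (ck_itv (Y z)).
have phi1_mono r s : r <= s -> f a * (s - r) <= phi1 s - phi1 r.
  by move=> rs; apply: primitive_ge => // z _; exact: H2lb.
have phi1_lb r : 0 <= r -> f a * r <= phi1 r.
  by move=> /phi1_mono; rewrite /phi1 primitive0 !subr0.
have W0 : W 0 = a by rewrite /W primitive0 addr0.
have cW : continuous W.
  by move=> r; apply: cvgD; [exact: cvg_cst|exact: primitive_continuous].
have dphi1 (r : R) : is_derive r 1 phi1 (h2 r) by exact: primitive_is_derive.
have dW (r : R) : is_derive r 1 W (h1 r).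
  by rewrite -[h1 r]add0r; exact: (is_deriveD (is_derive_cst a r 1)
    (primitive_is_derive r ch1)).
(* From the time K / f a on, phi1 is at least K, so that W has slope K there. *)
have [T T0 WT] : exists2 T, 0 < T & W T = M.
  pose s0 := K / f a; have s00 : 0 <= s0 by rewrite divr_ge0 // ltW.
  pose s1 := s0 + (M - a) / K.
  have s01 : s0 <= s1 by rewrite lerDl divr_ge0 // ltW.
  have Ws1 : M <= W s1.
    have k1 : K * (s1 - s0) <= primitive h1 s1 - primitive h1 s0.
      apply: primitive_ge => // z /andP[z0 _].
      have z00 : 0 <= z by exact: le_trans z0.
      rewrite /h1 /H1 /ck le_max le_min lexx andbT Yphi1 //.
      rewrite (le_trans _ (phi1_lb _ z00)) //.
      by rewrite mulrC -ler_pdivrMr.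
    have : W 0 <= W s0 by exact: W_mono.
    rewrite W0; move: k1; rewrite /s1 [s0 + _]addrC addrK mulrC divfK ?gt_eqF //.
    rewrite /W; lra.
  have [|T /andP[T0 _] WT] := @IVT_le R W 0 s1 M (le_trans s00 s01) cW.
    by rewrite W0 ltW.
  exists T => //; rewrite lt_neqAle T0 andbT; apply/eqP => T0'.
  by move: WT; rewrite -T0' W0 => aM'; move: aM; rewrite aM' ltxx.
have YK r : 0 <= r <= T -> phi1 r <= K.
  move=> /andP[r0 rT]; rewrite leNgt; apply/negP => rK.
  have cphi1 : continuous phi1 by exact: primitive_continuous.
  have [|r2 /andP[r20 r2r] Er2] := @IVT_le R phi1 0 r K r0 cphi1.
    by rewrite /phi1 primitive0 !ltW.
  have phi1_itv s : 0 <= s <= r2 -> 0 <= phi1 s <= K.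
    move=> /andP[s0 sr]; apply/andP; split.
      by rewrite (le_trans _ (phi1_lb _ s0)) // mulr_ge0 // ltW.
    rewrite -Er2 -subr_ge0; apply: le_trans (phi1_mono _ _ sr).
    by rewrite mulr_ge0 ?subr_ge0 // ltW.
  (* The energy is nondecreasing until the slope reaches K, at the time r2. *)
  pose E := Lk \*: W - 2^-1 \*: (phi1 * phi1).
  have dE (s : R) : is_derive s 1 E (Lk * h1 s - phi1 s * h2 s).
    have := dphi1 s => ?; have := dW s => ?.
    by apply: is_derive_eq; rewrite /= /GRing.scale /=; lra.
  have : E 0 <= E r2.
    apply: (ge0_derive_le r20 (fun s _ => dE s)) => s sr.
    have /andP[s0 _] := sr.
    rewrite /h1 /H1 Yphi1 // ck_id; last exact: phi1_itv.
    rewrite mulrC -mulrBr mulr_ge0 ?subr_ge0 ?H2ub //.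
    by case/andP: (phi1_itv _ sr).
  have WM : W r2 <= M by rewrite -WT W_mono // (le_trans r2r).
  have : Lk * W r2 <= Lk * M by rewrite ler_wpM2l // ltW.
  have E0 : E 0 = Lk * a.
    by rewrite /E !fctE /= W0 /phi1 primitive0 mulr0 scaler0 subr0.
  have Er : E r2 = Lk * W r2 - 2^-1 * (K * K) by rewrite /E !fctE /= Er2.
  rewrite E0 Er; move: HK; rewrite expr2 /Lk => hK h3 h4.
  suff : K * K / 2 <= (f M + g M * K `^ q) * (M - a) by lra.
  rewrite mulrBr; move: h3 h4; lra.
pose phi r := a + primitive phi1 r.
have cphi1 : continuous phi1 by exact: primitive_continuous.
have phi1_itv s : 0 <= s <= T -> 0 <= phi1 s <= K.
  move=> /[dup] /andP[s0 sr] /YK ->; rewrite andbT.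
  by rewrite (le_trans _ (phi1_lb _ s0)) // mulr_ge0 // ltW.
have phiW r : 0 <= r <= T -> phi r = W r.
  move=> /andP[r0 rT].
  have h1E z : 0 <= z <= r -> h1 z = phi1 z.
    move=> /andP[z0 zr]; rewrite /h1 /H1 Yphi1 // ck_id //.
    by apply: phi1_itv; rewrite z0 (le_trans zr).
  have p1 : primitive phi1 r - primitive phi1 0 <= primitive h1 r - primitive h1 0.
    by apply: primitive_mono => // z zr; rewrite h1E.
  have p2 : primitive h1 r - primitive h1 0 <= primitive phi1 r - primitive phi1 0.
    by apply: primitive_mono => // z zr; rewrite h1E.
  by move: p1 p2; rewrite !primitive0 !subr0 /phi /W; lra.
exists T, phi, phi1, h2; split.
- by split=> //; rewrite phiW // lexx ltW.
- by rewrite /phi /phi1 !primitive0 addr0.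
- split=> // r; rewrite -[phi1 r]add0r.
  exact: (is_deriveD (is_derive_cst a r 1) (primitive_is_derive r cphi1)).
- split=> // r rT; have /andP[r0 r0T] := rT.
  have WaM : a <= W r <= M by rewrite -{1}W0 -WT !W_mono.
  by rewrite /h2 /H2 XW // Yphi1 // -phiW // cl_id ?ck_id ?phi1_itv // phiW.
- exact: phi1_lb.
Qed.

(** * The integrand of Psi *)

Lemma primitiveB_itv (R : realType) (h : R -> R) (s t : R) : continuous h ->
  {homo h : x y / x <= y} -> t <= s ->
  h t * (s - t) <= primitive h s - primitive h t <= h s * (s - t).
Proof.
move=> ch mh ts; apply/andP; split.
  by apply: primitive_ge => // x /andP[tx xs]; exact: mh.
by apply: primitive_le => // x /andP[tx xs]; exact: mh.
Qed.

Lemma continuous_ge0_at0 (R : realType) (h : R -> R) : continuous h ->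
  (forall t, 0 < t -> 0 <= h t) -> 0 <= h 0.
Proof.
move=> ch h0; rewrite leNgt; apply/negP => hn.
have hn' : \forall y \near (0 : R), h y < 0 by exact: (cvgr_lt (h 0) (ch 0) 0 hn).
near (0 : R)^'+ => y.
have y0 : 0 < y by near: y; exact: nbhs_right_gt.
have : h y < 0 by near: y; exact: cvg_within hn'.
by rewrite ltNge h0.
Unshelve. all: by end_near. Qed.

Lemma admissible_g_ge0 (R : realType) (f g : R -> R) (t : R) :
  admissible f g -> 0 <= t -> 0 <= g t.
Proof.
move=> [[cf cg] [mf mg] fpos _ gpos]; rewrite le_eqVlt => /predU1P[<-|/gpos//].
exact: continuous_ge0_at0.
Qed.

Lemma admissible_f_ge0 (R : realType) (f g : R -> R) (t : R) :
  admissible f g -> 0 <= t -> 0 <= f t.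
Proof.
move=> [[cf cg] [mf mg] fpos _ gpos].
rewrite le_eqVlt => /predU1P[<-|/fpos[_ /ltW]//].
by apply: continuous_ge0_at0 => // s /fpos[_ /ltW].
Qed.

Lemma admissible_ge0 (R : realType) (f g : R -> R) (t s : R) :
  admissible f g -> 0 <= t -> t <= s -> 0 <= primitive g s - primitive g t.
Proof.
move=> hfg t0 ts; have [[_ cg] [_ mg] _ _ _] := hfg.
have /andP[+ _] := primitiveB_itv cg mg ts; apply: le_trans.
by rewrite mulr_ge0 ?(admissible_g_ge0 hfg) // subr_ge0.
Qed.

Lemma admissible_F_gt0 (R : realType) (f g : R -> R) (t s : R) :
  admissible f g -> 0 <= t -> t < s -> 0 < primitive f s - primitive f t.
Proof.
move=> hfg t0 ts; have [[cf _] [mf _] fpos _ _] := hfg.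
pose m := (t + s) / 2; have tm : t < m by rewrite /m; lra.
have ms : m < s by rewrite /m; lra.
have /andP[h1 _] := primitiveB_itv cf mf (ltW tm).
have /andP[h2 _] := primitiveB_itv cf mf (ltW ms).
have h3 : 0 < f m * (s - m).
  by rewrite mulr_gt0 ?subr_gt0 //; case: (fpos m (le_lt_trans t0 tm)).
have h4 : 0 <= f t * (m - t).
  by rewrite mulr_ge0 ?subr_ge0 ?(ltW tm) // (admissible_f_ge0 hfg).
lra.
Qed.

Lemma sqrtF_powG_gt0 (R : realType) (q : R) (f g : R -> R) (s t : R) :
  admissible f g -> 0 <= t -> t < s -> 0 < sqrtF_powG q f g s t.
Proof.
move=> hfg t0 ts; apply: ltr_wpDr; first exact: powR_ge0.
by rewrite sqrtr_gt0; exact: admissible_F_gt0 hfg _ _.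
Qed.

Lemma sqrtF_powG_inv_ge0 (R : realType) (q : R) (f g : R -> R) (s t : R) :
  0 <= (sqrtF_powG q f g s t)^-1.
Proof. by rewrite invr_ge0 addr_ge0 ?sqrtr_ge0 ?powR_ge0. Qed.

(** The increment of G is nonnegative on the region considered, so that the
power can be replaced by its continuous cutoff. *)
Lemma sqrtF_powG_comp_continuous (R : realType) (q : R) (f g : R -> R)
    (s t : R -> R) (x : R) : 0 < q < 2 -> admissible f g ->
  {for x, continuous s} -> {for x, continuous t} ->
  (\forall y \near x, 0 <= t y <= s y) ->
  {for x, continuous (fun y => sqrtF_powG q f g (s y) (t y))}.
Proof.
move=> /andP[q0 q2] hfg cs ct tsx.
have [[cf cg] [mf mg] fpos _ gpos] := hfg.
have th0 : 0 < (2 - q)^-1 by rewrite invr_gt0 subr_gt0.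
have cB (h : R -> R) : continuous h ->
    {for x, continuous (fun y => primitive h (s y) - primitive h (t y))}.
  move=> ch; apply: cvgB.
    apply: (@continuous_comp _ _ _ s (primitive h)); first exact: cs.
    exact: primitive_continuous.
  apply: (@continuous_comp _ _ _ t (primitive h)); first exact: ct.
  exact: primitive_continuous.
pose k y := Num.sqrt (primitive f (s y) - primitive f (t y)) +
  Num.max (primitive g (s y) - primitive g (t y)) 0 `^ (2 - q)^-1.
have kE y : 0 <= t y <= s y -> k y = sqrtF_powG q f g (s y) (t y).
  move=> /andP[t0 ts]; rewrite /k max_l //; exact: admissible_ge0 hfg _ _.
have ck : {for x, continuous k}.
  apply: cvgD.
    apply: (@continuous_comp _ _ _ (fun y => primitive f (s y) - primitive f (t y))
      Num.sqrt); first exact: cB.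
    exact: sqrt_continuous.
  apply: (@continuous_comp _ _ _ (fun y => primitive g (s y) - primitive g (t y))
      (fun z => Num.max z 0 `^ (2 - q)^-1)); first exact: cB.
  exact: continuous_pos_powR.
rewrite /prop_for /continuous_at -(kE x (nbhs_singleton tsx)).
by apply: cvg_trans ck; apply: near_eq_cvg; apply: filterS tsx => y /kE.
Qed.

Lemma sqrtF_powG_inv_continuous (R : realType) (q : R) (f g : R -> R)
    (s t : R) : 0 < q < 2 -> admissible f g -> 0 <= t < s ->
  {for s, continuous (fun y => (sqrtF_powG q f g y t)^-1)}.
Proof.
move=> hq hfg /andP[t0 ts].
apply: cvgV; first by rewrite gt_eqF // sqrtF_powG_gt0.
apply: (@sqrtF_powG_comp_continuous R q f g id (cst t)) => //.
  exact: cst_continuous.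
near=> y; rewrite t0 /=; apply: ltW; near: y; exact: lt_nbhsr.
Unshelve. all: by end_near. Qed.

Lemma sqrtF_powG_inv_measurable (R : realType) (q : R) (f g : R -> R) (t : R) :
  0 < q < 2 -> admissible f g -> 0 <= t ->
  measurable_fun `]t, +oo[ (EFin \o (fun s => (sqrtF_powG q f g s t)^-1)).
Proof.
move=> hq hfg t0; apply/measurable_EFinP.
apply: open_continuous_measurable_fun; first exact: interval_open.
move=> s; rewrite inE /= in_itv /= andbT => ts.
by apply: sqrtF_powG_inv_continuous => //; rewrite t0.
Qed.

(** * Lifetime of radial solutions *)

(** Up to the constant C, this is Psi, the bound for the time that a radial
solution starting from t needs to escape to infinity. *)
Definition escape_integral (R : realType) (q : R) (f g : R -> R) (t : R) : \bar R :=
  (\int[lebesgue_measure]_(s in `]t, +oo[) ((sqrtF_powG q f g s t)^-1)%:E)%E.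

(** This reduces lower bounds for the escape integral to primitives of
continuous functions on compact intervals, away from the singularity at s = t. *)
Lemma escape_segment (R : realType) (q : R) (f g : R -> R) (t u v : R) (k : R -> R) :
  0 < q < 2 -> admissible f g -> 0 <= t -> t < u -> u <= v -> continuous k ->
  (forall s, u <= s <= v -> k s <= (sqrtF_powG q f g s t)^-1) ->
  ((primitive k v - primitive k u)%:E <= escape_integral q f g t)%E.
Proof.
move=> hq hfg t0 tu uv ck kS.
pose k' s := (sqrtF_powG q f g (Num.max s u) t)^-1.
have ck' : continuous k'.
  move=> s; apply: (@continuous_comp _ _ _ (fun s => Num.max s u)
    (fun s => (sqrtF_powG q f g s t)^-1)).
    by apply: (@continuous_maxr _ id) => z; exact: cvg_id.
  apply: sqrtF_powG_inv_continuous => //; rewrite t0.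
  by rewrite lt_max tu orbT.
have kk' : primitive k v - primitive k u <= primitive k' v - primitive k' u.
  apply: (primitive_mono ck ck' uv) => s /andP[us sv]; rewrite /k' max_l //.
  by apply: kS; rewrite us.
apply: (@le_trans _ _ (primitive k' v - primitive k' u)%:E).
  by rewrite lee_fin.
rewrite -(primitive_itv ck' uv).
have -> : (\int[lebesgue_measure]_(s in `[u, v]) (k' s)%:E =
    \int[lebesgue_measure]_(s in `[u, v]) ((sqrtF_powG q f g s t)^-1)%:E)%E.
  apply: eq_integral => s.
  by rewrite inE /= in_itv /= => /andP[us _]; rewrite /k' max_l.
apply: ge0_subset_integral => //.
- exact: sqrtF_powG_inv_measurable.
- by move=> s _; rewrite lee_fin sqrtF_powG_inv_ge0.
- move=> s /=; rewrite !in_itv /= andbT => /andP[us _]; exact: lt_le_trans us.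
Qed.

(** The differential inequality says that the primitive of 1 / S(s, a),
evaluated along phi, grows at least with slope kappa. The comparison is made
on [e, T - e], because the integrand is singular at a; then e tends to 0. *)
Lemma lifetime_le_escape (R : realType) (q a kappa T : R) (f g phi phi1 : R -> R) :
  0 < q < 2 -> admissible f g -> 0 < a -> 0 < T ->
  (forall r : R, is_derive r 1 phi (phi1 r)) ->
  (forall r, 0 < r <= T -> a < phi r) ->
  (forall r, 0 < r < T -> 0 <= phi1 r) ->
  (forall r, 0 < r < T -> kappa * sqrtF_powG q f g (phi r) a <= phi1 r) ->
  ((kappa * T)%:E <= escape_integral q f g a)%E.
Proof.
move=> hq hfg a0 T0 dphi phia phi1_ge0 key.
have [k0|k0] := ltP 0 kappa; last first.
  apply: (@le_trans _ _ 0%E).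
    by rewrite lee_fin mulr_le0_ge0 // ltW.
  by apply: integral_ge0 => s _; rewrite lee_fin sqrtF_powG_inv_ge0.
have main e : 0 < e -> e < T / 2 -> ((kappa * (T - e - e))%:E <= escape_integral q f g a)%E.
  move=> e0 eT; pose u := phi e; pose v := phi (T - e).
  have eT' : e <= T - e by lra.
  have au : a < u by apply: phia; rewrite e0; lra.
  have itv r : e <= r <= T - e -> 0 < r < T by move=> /andP[h1 h2]; apply/andP; split; lra.
  have phi_mono r s : e <= r -> r <= s -> s <= T - e -> phi r <= phi s.
    move=> er rs sT; apply: (ge0_derive_le rs (fun x _ => dphi x)) => x /andP[rx xs].
    by apply/phi1_ge0/itv; rewrite (le_trans er) // (le_trans xs).
  pose k s := (sqrtF_powG q f g (Num.max s u) a)^-1.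
  have ck : continuous k.
    move=> s; apply: (@continuous_comp _ _ _ (fun s => Num.max s u)
      (fun s => (sqrtF_powG q f g s a)^-1)).
      by apply: (@continuous_maxr _ id) => z; exact: cvg_id.
    apply: sqrtF_powG_inv_continuous => //; rewrite (ltW a0).
    by rewrite lt_max au orbT.
  pose D := (primitive k \o phi) - kappa \*: id.
  have dD (r : R) : is_derive r 1 D (k (phi r) * phi1 r - kappa).
    have dk := primitive_is_derive (phi r) ck.
    have dc : is_derive r 1 (primitive k \o phi) (k (phi r) * phi1 r).
      exact: is_derive1_comp.
    have := is_deriveZ kappa (is_derive_id r 1) => d2.
    by apply: is_derive_eq; rewrite /= /GRing.scale /= mulr1.
  have : D e <= D (T - e).
    apply: (ge0_derive_le eT' (fun x _ => dD x)) => x xe.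
    have /andP[ex xT] := xe; rewrite /k max_l; last exact: phi_mono.
    rewrite subr_ge0 mulrC ler_pdivlMr ?key ?itv //.
    apply: sqrtF_powG_gt0 => //; first exact: ltW.
    by apply: phia; have /andP[-> /ltW] := itv _ xe.
  rewrite /D !fctE /= /GRing.scale /= -/u -/v => DD.
  apply: (@le_trans _ _ (primitive k v - primitive k u)%:E).
    by rewrite lee_fin; lra.
  have uv : u <= v by exact: phi_mono.
  apply: (escape_segment hq hfg (ltW a0) au uv ck).
  by move=> s /andP[us sv]; rewrite /k max_l.
have t0 : (0 <= escape_integral q f g a)%E.
  by apply: integral_ge0 => s _; rewrite lee_fin sqrtF_powG_inv_ge0.
move: t0 main; case: (escape_integral q f g a) => [x| |] //; last by move=> _ _; rewrite leey.
rewrite !lee_fin => x0 main; rewrite leNgt; apply/negP => xT.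
pose e := Num.min (T / 4) ((kappa * T - x) / (4 * kappa)).
have e0 : 0 < e by rewrite lt_min !divr_gt0 ?mulr_gt0 // subr_gt0.
have eT : e <= T / 4 by rewrite ge_min lexx.
have ek : e * (4 * kappa) <= kappa * T - x.
  by rewrite -ler_pdivlMr ?mulr_gt0 // ge_min lexx orbT.
have /main : e < T / 2 by lra.
by move=> /(_ e0); rewrite lee_fin; move: ek; nra.
Qed.

(** * Finiteness of the escape integral *)

Lemma continuous_inv_max (R : realType) (u : R) : 0 < u ->
  continuous (fun s : R => (Num.max s u)^-1).
Proof.
move=> u0 s; apply: cvgV; first by rewrite gt_eqF // lt_max u0 orbT.
by apply: (@continuous_maxr _ id) => z; exact: cvg_id.
Qed.

Lemma primitive_inv_max (R : realType) (u v : R) : 0 < u -> u <= v ->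
  ln v - ln u <=
  primitive (fun s => (Num.max s u)^-1) v - primitive (fun s => (Num.max s u)^-1) u.
Proof.
move=> u0 uv; set k := fun s => _.
have ck : continuous k by exact: continuous_inv_max.
have d x : u <= x <= v -> is_derive x 1 (primitive k - @ln R) 0.
  move=> /andP[ux xv]; have x0 : 0 < x by exact: lt_le_trans ux.
  have := primitive_is_derive x ck => ?; have := is_derive1_ln x0 => ?.
  by apply: is_derive_eq; rewrite /k max_l // subrr.
have := @ge0_derive_le _ _ (fun=> 0) u v uv d (fun _ _ => lexx _).
by rewrite !fctE; lra.
Qed.

(** A linear upper bound for S makes the integral at least logarithmic. *)
Lemma escape_ge_ln (R : realType) (q : R) (f g : R -> R) (t u v c : R) :
  0 < q < 2 -> admissible f g -> 0 <= t -> t < u -> u <= v -> 0 < c ->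
  (forall s, u <= s <= v -> sqrtF_powG q f g s t <= c * s) ->
  ((c^-1 * (ln v - ln u))%:E <= escape_integral q f g t)%E.
Proof.
move=> hq hfg t0 tu uv c0 Sc; have u0 : 0 < u by exact: le_lt_trans tu.
pose k s := c^-1 * (Num.max s u)^-1.
have ck0 := continuous_inv_max u0.
have ck : continuous k by move=> s; apply: cvgMr; exact: ck0.
apply: (@le_trans _ _ (primitive k v - primitive k u)%:E).
  rewrite lee_fin /k !(primitive_scale _ _ ck0) -mulrBr ler_wpM2l ?invr_ge0 ?(ltW c0) //.
  exact: primitive_inv_max.
apply: (escape_segment hq hfg t0 tu uv ck) => s suv; have /andP[us _] := suv.
rewrite /k max_l // -invfM lef_pV2 ?posrE ?Sc //.
  by rewrite mulr_gt0 // (lt_le_trans u0).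
by apply: sqrtF_powG_gt0 => //; exact: lt_le_trans us.
Qed.

Lemma le_integral_scale (R : realType) (D : set R) (w1 w2 : R -> R) (c : R) :
  measurable D -> 0 <= c -> (forall x, D x -> 0 <= w1 x) ->
  (forall x, D x -> 0 <= w2 x) ->
  measurable_fun D w1 -> measurable_fun D w2 ->
  (forall x, D x -> w1 x <= c * w2 x) ->
  (\int[lebesgue_measure]_(x in D) (w1 x)%:E
   <= c%:E * \int[lebesgue_measure]_(x in D) (w2 x)%:E)%E.
Proof.
move=> mD c0 w10 w20 mw1 mw2 w12.
rewrite -ge0_integralZl_EFin //.
- apply: ge0_le_integral.
  + exact: mD.
  + by move=> x Dx; rewrite lee_fin w10.
  + exact/measurable_EFinP.
  + apply: emeasurable_funM; first exact: measurable_cst.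
    exact/measurable_EFinP.
  + by move=> x Dx; rewrite -EFinM lee_fin w12.
- exact/measurable_EFinP.
Qed.

(** Monotone convergence along the segments that exhaust the half-open
interval. *)
Lemma integral_oc_le (R : realType) (w : R -> R) (t b B : R) :
  measurable_fun `]t, b] (EFin \o w) -> (forall s, 0 <= w s) ->
  (forall u, t < u -> u <= b ->
    (\int[lebesgue_measure]_(s in `[u, b]) (w s)%:E <= B%:E)%E) -> 0 <= B ->
  (\int[lebesgue_measure]_(s in `]t, b]) (w s)%:E <= B%:E)%E.
Proof.
move=> mw w0 wB B0.
pose A n : set R := `[t + n.+1%:R^-1, b]%classic.
have Atb n : A n `<=` `]t, b]%classic.
  move=> x; rewrite /A /= !in_itv /= => /andP[+ ->]; rewrite andbT.
  by apply: lt_le_trans; rewrite ltrDl invr_gt0.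
have AE : `]t, b]%classic = \bigcup_n A n.
  exact: (itv_open_bnd_bigcup false b t).
rewrite AE.
have ndA : nondecreasing_seq A.
  move=> m n mn; apply/subsetPset => x; rewrite /A /= !in_itv /= => /andP[+ ->].
  rewrite andbT; apply: le_trans; rewrite lerD2l lef_pV2 ?posrE ?ltr0n //.
  by rewrite ler_nat.
have mA n : measurable (A n) by exact: measurable_itv.
have := @ge0_nondecreasing_set_cvg_integral _ (measurableTypeR R) R A (EFin \o w)
  (@lebesgue_measure R)
  ndA mA (fun n => measurable_funS (measurable_itv _) (@Atb n) mw)
  (fun n x _ => ltac:(by rewrite lee_fin)).
apply: cvge_le; apply: nearW => n.
have [nb|nb] := leP (t + n.+1%:R^-1) b.
  by apply: wB => //; rewrite ltrDl invr_gt0.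
rewrite /A set_itv_ge ?bnd_simp -?ltNge // integral_set0 lee_fin //.
Qed.

(** Since f and g are nondecreasing, an increment over [t, s] with s >= 2 t is
at least half the increment over [0, s]. *)
Lemma sqrtF_powG_half (R : realType) (q : R) (f g : R -> R) (s t : R) :
  0 < q < 2 -> admissible f g -> 0 < t -> 2 * t <= s ->
  2^-1 `^ (2 - q)^-1 * sqrtF_powG q f g s 0 <= sqrtF_powG q f g s t.
Proof.
move=> /andP[q0 q2] hfg t0 ts; have q2' : 0 < 2 - q by rewrite subr_gt0.
have ts' : t <= s by lra.
have s0 : 0 <= s by lra.
have half (h : R -> R) : continuous h -> {homo h : x y / x <= y} -> 0 <= h t ->
    2^-1 * (primitive h s - primitive h 0) <= primitive h s - primitive h t.
  move=> ch mh ht.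
  have /andP[h1 _] := primitiveB_itv ch mh ts'.
  have /andP[_ h2] := primitiveB_itv ch mh (ltW t0).
  have : h t * (t - 0) <= h t * (s - t) by rewrite ler_wpM2l //; lra.
  lra.
have [[cf cg] [mf mg] _ _ _] := hfg.
have th : 2^-1 <= (2 - q)^-1 by rewrite lef_pV2 ?posrE //; lra.
set th2 := (2 - q)^-1 in th *.
have th0 : 0 < th2 by rewrite invr_gt0.
rewrite /sqrtF_powG -/th2 mulrDr; apply: lerD.
  apply: (@le_trans _ _ (2^-1 `^ 2^-1 * Num.sqrt (primitive f s - primitive f 0))).
    rewrite ler_wpM2r ?sqrtr_ge0 //; apply: ger_powR => //.
    by rewrite invr_gt0 invf_le1 //; apply/andP; split; lra.
  rewrite powR12_sqrt ?invr_ge0 // -sqrtrM ?invr_ge0 // ler_wsqrtr //.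
  by apply: half => //; rewrite (admissible_f_ge0 hfg) // ltW.
have G0 : 0 <= primitive g s - primitive g 0 by exact: admissible_ge0 hfg _ _.
rewrite -powRM ?invr_ge0 //; apply: le_powR => //.
  by rewrite mulr_ge0 // invr_ge0.
by apply: half => //; rewrite (admissible_g_ge0 hfg) // ltW.
Qed.

(** At infinity the integrand is compared with the one of the integrability
hypothesis; near s = t it is at most (f(t) (s - t))^(-1/2), which has a
bounded primitive. *)
Lemma escape_finite (R : realType) (q : R) (f g : R -> R) (t : R) :
  0 < q < 2 -> admissible f g -> 0 < t ->
  (\int[lebesgue_measure]_(s in `[1%R, +oo[)
     ((sqrtF_powG q f g s 0)^-1)%:E < +oo)%E ->
  (escape_integral q f g t < +oo)%E.
Proof.
move=> hq hfg t0 hint; have [b b1 b2] : exists2 b, 1 <= b & 2 * t <= b.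
  by exists (Num.max (2 * t) 1); rewrite le_max lexx ?orbT.
have tb : t < b by lra.
have [[cf cg] [mf mg] fpos _ _] := hfg.
have ft : 0 < f t by case: (fpos t t0).
have mw := sqrtF_powG_inv_measurable hq hfg (ltW t0).
have w0 s : (0 <= ((sqrtF_powG q f g s t)^-1)%:E)%E.
  by rewrite lee_fin sqrtF_powG_inv_ge0.
rewrite /escape_integral (@itv_bndbnd_setU _ _ _ (BRight b)); [|by rewrite bnd_simp ltW|by []].
rewrite ge0_integral_setU //=; last 2 first.
- by rewrite -itv_bndbnd_setU // bnd_simp ltW.
- apply/disj_set2P; rewrite -subset0 => x [/=]; rewrite !in_itv /= andbT.
  by move=> /andP[_ xb] /(le_lt_trans xb); rewrite ltxx.
apply: lte_add_pinfty.
- pose B := 2 * Num.sqrt (b - t) / Num.sqrt (f t).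
  have B0 : 0 <= B by rewrite divr_ge0 ?mulr_ge0 ?sqrtr_ge0.
  apply: le_lt_trans (ltry B).
  apply: (@integral_oc_le _ (fun s => (sqrtF_powG q f g s t)^-1)) => //.
    by apply: measurable_funS mw => //; apply: subset_itvl; rewrite bnd_simp.
  move=> u tu ub.
  pose k s := (sqrtF_powG q f g (Num.max s u) t)^-1.
  have ck : continuous k.
    move=> s; apply: (@continuous_comp _ _ _ (fun s => Num.max s u)
      (fun s => (sqrtF_powG q f g s t)^-1)).
      by apply: (@continuous_maxr _ id) => z; exact: cvg_id.
    apply: sqrtF_powG_inv_continuous => //; rewrite (ltW t0).
    by rewrite lt_max tu orbT.
  have -> : (\int[lebesgue_measure]_(s in `[u, b]) ((sqrtF_powG q f g s t)^-1)%:E =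
      \int[lebesgue_measure]_(s in `[u, b]) (k s)%:E)%E.
    apply: eq_integral => s.
    by rewrite inE /= in_itv /= => /andP[us _]; rewrite /k max_l.
  rewrite (primitive_itv ck ub) lee_fin.
  pose D := (2 / Num.sqrt (f t)) \*: (Num.sqrt \o (fun s => s - t)) - primitive k.
  have dD (x : R) : u <= x <= b ->
      is_derive x 1 D ((Num.sqrt (x - t) * Num.sqrt (f t))^-1 - k x).
    move=> /andP[ux xb]; have tx : 0 < x - t by rewrite subr_gt0 (lt_le_trans tu).
    have dk := primitive_is_derive x ck.
    have d1 : is_derive x 1 (fun s => s - t) 1.
      by have := is_deriveB (is_derive_id x 1) (is_derive_cst t x 1); rewrite subr0.
    have d2 := is_derive1_sqrt tx.
    have d3 : is_derive x 1 (Num.sqrt \o (fun s => s - t))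
        ((2 * Num.sqrt (x - t))^-1 * 1) by exact: is_derive1_comp.
    apply: is_derive_eq; congr (_ - _); rewrite /GRing.scale /=.
    have sx : Num.sqrt (x - t) != 0 by rewrite gt_eqF // sqrtr_gt0.
    have sf : Num.sqrt (f t) != 0 by rewrite gt_eqF // sqrtr_gt0.
    by field; rewrite sx sf.
  have : D u <= D b.
    apply: (ge0_derive_le ub dD) => x /andP[ux xb].
    have tx : t < x by exact: lt_le_trans ux.
    rewrite subr_ge0 /k max_l // lef_pV2 ?posrE; last 2 first.
    + by apply: sqrtF_powG_gt0 => //; exact: ltW.
    + by rewrite mulr_gt0 // sqrtr_gt0 // subr_gt0.
    rewrite -sqrtrM ?subr_ge0 ?(ltW tx) // /sqrtF_powG.
    apply: ler_wpDr; first exact: powR_ge0.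
    apply: ler_wsqrtr; rewrite mulrC.
    by case/andP: (primitiveB_itv cf mf (ltW tx)).
  rewrite /D !fctE /= /GRing.scale /=.
  have : 0 <= 2 / Num.sqrt (f t) * Num.sqrt (u - t).
    by rewrite mulr_ge0 ?divr_ge0 ?sqrtr_ge0.
  by rewrite /B; lra.
- pose c : R := 2^-1 `^ (2 - q)^-1.
  have c0 : 0 < c by rewrite powR_gt0 // invr_gt0.
  have m0 : measurable_fun `]b, +oo[ (EFin \o (fun s => (sqrtF_powG q f g s 0)^-1)).
    apply: measurable_funS (sqrtF_powG_inv_measurable hq hfg (lexx 0)) => //.
    by apply: subset_itvr; rewrite bnd_simp; lra.
  have m1 : measurable_fun `]b, +oo[ (EFin \o (fun s => (sqrtF_powG q f g s t)^-1)).
    by apply: measurable_funS mw => //; apply: subset_itvr; rewrite bnd_simp; exact: ltW.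
  apply: (@le_lt_trans _ _ (c^-1%:E * \int[lebesgue_measure]_(s in `]b, +oo[)
     ((sqrtF_powG q f g s 0)^-1)%:E)%E).
    apply: le_integral_scale.
    + exact: measurable_itv.
    + by rewrite invr_ge0 ltW.
    + by move=> s _; exact: sqrtF_powG_inv_ge0.
    + by move=> s _; exact: sqrtF_powG_inv_ge0.
    + by move/measurable_EFinP : m1; exact.
    + by move/measurable_EFinP : m0; exact.
    move=> s /=; rewrite in_itv /= andbT => bs.
    rewrite -invfM lef_pV2 ?posrE.
    + by apply: sqrtF_powG_half => //; lra.
    + by apply: sqrtF_powG_gt0 => //; lra.
    + by rewrite mulr_gt0 // sqrtF_powG_gt0 //; lra.
  apply: lte_mul_pinfty => //; first by rewrite lee_fin invr_ge0 ltW.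
  apply: le_lt_trans hint; apply: ge0_subset_integral.
  + exact: measurable_itv.
  + exact: measurable_itv.
  + apply: measurable_funS (sqrtF_powG_inv_measurable hq hfg (lexx 0)) => //.
    by move=> s /=; rewrite !in_itv /= !andbT; apply: lt_le_trans.
  + by move=> s _; rewrite lee_fin sqrtF_powG_inv_ge0.
  + by move=> s /=; rewrite !in_itv /= !andbT => /ltW; exact: le_trans.
Qed.

(** * Monotonicity of the escape integral *)

Lemma measurable_shift (R : realType) (t : R) :
  measurable_fun setT (+%R t : measurableTypeR R -> measurableTypeR R).
Proof.
apply: continuous_measurable_fun => x; apply: cvgD; first exact: cvg_cst.
exact: cvg_id.
Qed.

Lemma lebesgue_measure_shift (R : realType) (t : R) (A : set R) :
  measurable A ->
  pushforward lebesgue_measure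
    (+%R t : measurableTypeR R -> measurableTypeR R) A = lebesgue_measure A.
Proof.
move=> mA; have mt := measurable_shift t.
pose mphi := isMeasurableFun.Build _ _ _ _ _ mt.
pose phi : {mfun measurableTypeR R >-> measurableTypeR R} :=
  HB.pack (+%R t : measurableTypeR R -> measurableTypeR R) mphi.
apply/esym; apply: (@lebesgue_measure_unique R
  (pushforward lebesgue_measure phi)) => // _ [[a b]] _ <-.
have E : `](a - t), (b - t)]%classic = phi @^-1` `]a, b]%classic.
  by apply/seteqP; split=> x /=; rewrite !in_itv /= ltrBlDl lerBrDl.
rewrite /pushforward; transitivity (lebesgue_measure `](a - t), (b - t)]%classic).
  rewrite !lebesgue_measure_itv /= !lte_fin ltrD2r.
  by case: ifP => // _; rewrite -!EFinB; congr EFin; lra.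
by congr lebesgue_measure.
Qed.

Lemma integral_shift (R : realType) (t : R) (w : R -> R) :
  measurable_fun `]t, +oo[ w -> (forall s, 0 <= w s) ->
  (\int[lebesgue_measure]_(s in `]t, +oo[) (w s)%:E
   = \int[lebesgue_measure]_(s in `]0%R, +oo[) (w (t + s))%:E)%E.
Proof.
move=> mw w0.
have -> : `]0%R, +oo[%classic = (+%R t : measurableTypeR R -> measurableTypeR R)
    @^-1` `]t, +oo[%classic.
  by apply/seteqP; split=> x /=; rewrite !in_itv /= !andbT ltrDl.
rewrite -(@ge0_integral_pushforward _ _ (measurableTypeR R) (measurableTypeR R) R
  (+%R t) (measurable_shift t) lebesgue_measure `]t, +oo[%classic (EFin \o w)).
- apply: eq_measure_integral => [|mm A mA _].
    exact: measurable_shift.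
  exact/esym/lebesgue_measure_shift.
- exact: measurable_itv.
- exact/measurable_EFinP.
- by move=> x _; rewrite lee_fin.
Qed.

Definition shifted_integrand (R : realType) (q : R) (f g : R -> R) (t s : R) : R :=
  (sqrtF_powG q f g (t + s) t)^-1.

(** With s = t + sigma the domain of integration no longer depends on t, and
the integrand becomes monotone in t. *)
Lemma escape_shifted (R : realType) (q : R) (f g : R -> R) (t : R) :
  0 < q < 2 -> admissible f g -> 0 < t ->
  escape_integral q f g t
  = (\int[lebesgue_measure]_(s in `]0%R, +oo[) (shifted_integrand q f g t s)%:E)%E.
Proof.
move=> hq hfg t0; rewrite /escape_integral.
apply: (@integral_shift _ t (fun s => (sqrtF_powG q f g s t)^-1)).
  by apply/measurable_EFinP; exact: (sqrtF_powG_inv_measurable hq hfg (ltW t0)).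
by move=> s; exact: sqrtF_powG_inv_ge0.
Qed.

Lemma escape_ge0 (R : realType) (q : R) (f g : R -> R) (t : R) :
  (0 <= escape_integral q f g t)%E.
Proof. by apply: integral_ge0 => s _; rewrite lee_fin sqrtF_powG_inv_ge0. Qed.

Lemma shifted_ge0 (R : realType) (q : R) (f g : R -> R) (t s : R) :
  0 <= shifted_integrand q f g t s.
Proof. exact: sqrtF_powG_inv_ge0. Qed.

Lemma shifted_measurable (R : realType) (q : R) (f g : R -> R) (t : R) :
  0 < q < 2 -> admissible f g -> 0 < t ->
  measurable_fun `]0%R : R, +oo[ (shifted_integrand q f g t).
Proof.
move=> hq hfg t0.
apply: open_continuous_measurable_fun; first exact: interval_open.
move=> s; rewrite inE /= in_itv /= andbT => s0.
apply: (@continuous_comp _ _ _ (fun s => t + s)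
  (fun s => (sqrtF_powG q f g s t)^-1)).
  by apply: cvgD; [exact: cvg_cst|exact: cvg_id].
by apply: sqrtF_powG_inv_continuous => //; rewrite (ltW t0) ltrDl.
Qed.

Lemma primitive_increment_is_derive (R : realType) (h : R -> R) (s x : R) :
  continuous h ->
  is_derive x 1 (fun t => primitive h (t + s) - primitive h t) (h (x + s) - h x).
Proof.
move=> ch; have d1 := primitive_is_derive x ch.
have d2 := primitive_is_derive (x + s) ch.
have d3 : is_derive x 1 (fun y => y + s) 1.
  by have := is_deriveD (is_derive_id x 1) (is_derive_cst s x 1); rewrite addr0.
have d4 : is_derive x 1 (primitive h \o (fun y => y + s)) (h (x + s) * 1).
  exact: is_derive1_comp.
by rewrite -[h (x + s)]mulr1; exact: is_deriveB.
Qed.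

Lemma primitive_increment_mono (R : realType) (h : R -> R) (t t' s : R) :
  continuous h -> {homo h : x y / x <= y} -> 0 <= s -> t <= t' ->
  primitive h (t + s) - primitive h t <= primitive h (t' + s) - primitive h t'.
Proof.
move=> ch mh s0 tt.
apply: (ge0_derive_le tt (fun x _ => primitive_increment_is_derive s x ch)).
by move=> x _; rewrite subr_ge0 mh // lerDl.
Qed.

Lemma primitive_increment_strict (R : realType) (h : R -> R) (t t' s : R) :
  continuous h -> {homo h : x y / x < y} -> 0 < s -> t < t' ->
  primitive h (t + s) - primitive h t < primitive h (t' + s) - primitive h t'.
Proof.
move=> ch mh s0 tt.
have [c _ E] :=
  MVT_closed (ltW tt) (fun x _ => primitive_increment_is_derive s x ch).
by rewrite -subr_gt0 E mulr_gt0 ?subr_gt0 // mh // ltrDl.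
Qed.

Lemma shifted_anti (R : realType) (q : R) (f g : R -> R) (t t' s : R) :
  0 < q < 2 -> admissible f g -> 0 < t -> t <= t' -> 0 < s ->
  shifted_integrand q f g t' s <= shifted_integrand q f g t s.
Proof.
move=> /andP[q0 q2] hfg t0 tt s0; have [[cf cg] [mf mg] _ _ _] := hfg.
have th : 0 < (2 - q)^-1 by rewrite invr_gt0 subr_gt0.
have s0' := ltW s0; have t0' : 0 < t' by exact: lt_le_trans tt.
have S0 : 0 < sqrtF_powG q f g (t + s) t.
  by apply: (sqrtF_powG_gt0 _ hfg (ltW t0)); rewrite ltrDl.
have S0' : 0 < sqrtF_powG q f g (t' + s) t'.
  by apply: (sqrtF_powG_gt0 _ hfg (ltW t0')); rewrite ltrDl.
rewrite /shifted_integrand lef_pV2; [|by rewrite posrE; exact: S0'|by rewrite posrE; exact: S0].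
apply: lerD; first by rewrite ler_wsqrtr // primitive_increment_mono.
apply: le_powR => //; last exact: primitive_increment_mono.
by apply: (admissible_ge0 hfg); rewrite ?lerDl ?ltW.
Qed.

Lemma shifted_strict_anti (R : realType) (q : R) (f g : R -> R) (t t' s : R) :
  0 < q < 2 -> admissible f g -> 0 < t -> t < t' -> 0 < s ->
  shifted_integrand q f g t' s < shifted_integrand q f g t s.
Proof.
move=> /andP[q0 q2] hfg t0 tt s0; have [[cf cg] [mf mg] _ st _] := hfg.
have th : 0 < (2 - q)^-1 by rewrite invr_gt0 subr_gt0.
have s0' := ltW s0; have t0' : 0 < t' by exact: lt_trans tt.
have S0 : 0 < sqrtF_powG q f g (t + s) t.
  by apply: (sqrtF_powG_gt0 _ hfg (ltW t0)); rewrite ltrDl.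
have S0' : 0 < sqrtF_powG q f g (t' + s) t'.
  by apply: (sqrtF_powG_gt0 _ hfg (ltW t0')); rewrite ltrDl.
rewrite /shifted_integrand ltf_pV2; [|by rewrite posrE; exact: S0'|by rewrite posrE; exact: S0].
have F0 (x : R) : 0 < x -> 0 < primitive f (x + s) - primitive f x.
  by move=> x0; apply: (admissible_F_gt0 hfg); rewrite ?ltrDl ?ltW.
have G0 (x : R) : 0 < x -> 0 <= primitive g (x + s) - primitive g x.
  by move=> x0; apply: (admissible_ge0 hfg); rewrite ?lerDl ?ltW.
case: st => st.
- apply: ltr_leD.
    by rewrite ltr_sqrt ?F0 // primitive_increment_strict.
  apply: le_powR => //; [exact: G0|apply: primitive_increment_mono => //; exact: ltW].
- apply: ler_ltD.
    rewrite ler_wsqrtr // primitive_increment_mono //; exact: ltW.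
  apply: gt0_ltr_powR => //; rewrite ?nnegrE ?G0 //.
  exact: primitive_increment_strict.
Qed.

Lemma escape_le (R : realType) (q : R) (f g : R -> R) (t t' : R) :
  0 < q < 2 -> admissible f g -> 0 < t -> t <= t' ->
  (escape_integral q f g t' <= escape_integral q f g t)%E.
Proof.
move=> hq hfg t0 tt; have t0' : 0 < t' by exact: lt_le_trans tt.
rewrite (escape_shifted hq hfg t0) (escape_shifted hq hfg t0') -[leRHS]mul1e.
apply: le_integral_scale.
- exact: measurable_itv.
- exact: ler01.
- by move=> x _; exact: shifted_ge0.
- by move=> x _; exact: shifted_ge0.
- exact: shifted_measurable hq hfg t0'.
- exact: shifted_measurable hq hfg t0.
- move=> x /=; rewrite in_itv /= andbT => x0.
  by rewrite mul1r; exact: shifted_anti.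
Qed.

Lemma integral_sub_EFin (R : realType) (D : set R) (w1 w2 : R -> R) :
  measurable D -> (forall x, D x -> 0 <= w2 x) ->
  (forall x, D x -> w2 x <= w1 x) ->
  measurable_fun D w1 -> measurable_fun D w2 ->
  (\int[lebesgue_measure]_(x in D) (w1 x)%:E =
   \int[lebesgue_measure]_(x in D) (w2 x)%:E +
   \int[lebesgue_measure]_(x in D) (w1 x - w2 x)%:E)%E.
Proof.
move=> mD w20 w12 m1 m2; rewrite -ge0_integralD //.
- by apply: eq_integral => s _; rewrite -EFinD addrC subrK.
- exact/measurable_EFinP.
- by move=> x Dx; rewrite lee_fin subr_ge0 w12.
- by apply/measurable_EFinP; exact: measurable_funB.
Qed.

Lemma adde_self_eq0 (R : realType) (x y : \bar R) : x \is a fin_num ->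
  (x = x + y -> y = 0)%E.
Proof.
case: x => [x| |] // _; case: y => [y| |] //=; rewrite -EFinD => -[h].
by congr EFin; lra.
Qed.

(** Equality of the integrals would make a positive function vanish almost
everywhere on a half-line. *)
Lemma escape_lt (R : realType) (q : R) (f g : R -> R) (t t' : R) :
  0 < q < 2 -> admissible f g -> 0 < t -> t < t' -> (escape_integral q f g t < +oo)%E ->
  (escape_integral q f g t' < escape_integral q f g t)%E.
Proof.
move=> hq hfg t0 tt fin; have t0' : 0 < t' by exact: lt_trans tt.
rewrite lt_neqAle escape_le ?(ltW tt) // andbT; apply/eqP => E.
pose D : set R := `]0%R, +oo[%classic.
pose d s := shifted_integrand q f g t s - shifted_integrand q f g t' s.
have mD : measurable D by exact: measurable_itv.
have md : measurable_fun D d.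
  by apply: measurable_funB; exact: shifted_measurable.
have d0 s : D s -> 0 < d s.
  rewrite /D /= in_itv /= andbT => s0; rewrite subr_gt0.
  exact: shifted_strict_anti.
have Id : (\int[lebesgue_measure]_(s in D) (d s)%:E = 0)%E.
  have : (escape_integral q f g t = escape_integral q f g t' +
      \int[lebesgue_measure]_(s in D) (d s)%:E)%E.
    rewrite (escape_shifted hq hfg t0) (escape_shifted hq hfg t0').
    apply: integral_sub_EFin => [|x _|x Dx||].
    - exact: mD.
    - exact: shifted_ge0.
    - by apply: ltW; rewrite -subr_gt0; exact: (d0 x Dx).
    - exact: shifted_measurable hq hfg t0.
    - exact: shifted_measurable hq hfg t0'.
  by rewrite E; apply: adde_self_eq0; rewrite (ge0_fin_numE (escape_ge0 q f g t)).
have /ae_eq_integral_abs : (\int[lebesgue_measure]_(s in D) `|(d s)%:E| = 0)%E.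
  rewrite -[RHS]Id; apply: eq_integral => s; rewrite inE => Ds.
  by apply: gee0_abs; rewrite lee_fin; exact: ltW (d0 s Ds).
move=> /(_ mD ((measurable_EFinP _ _).2 md)) [N [mN N0 sub]].
have DN : D `<=` N.
  move=> s Ds; apply: sub => /= /(_ Ds) -[ds]; have := d0 s Ds.
  by rewrite ds ltxx.
clear fin E.
have : (lebesgue_measure D <= 0)%E by rewrite -N0 le_measure // inE.
by rewrite /D lebesgue_measure_itv /= ltry.
Qed.

(** * Range of the escape integral *)

Lemma dominated_EFin (R : realType) (D : set R) (w_ : nat -> R -> R)
    (w v : R -> R) :
  measurable D -> (forall n, measurable_fun D (w_ n)) -> measurable_fun D w ->
  measurable_fun D v ->
  (forall x, D x -> w_ n x @[n --> \oo] --> w x) ->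
  (forall n x, D x -> 0 <= w_ n x <= v x) ->
  (\int[lebesgue_measure]_(x in D) (v x)%:E < +oo)%E ->
  (\int[lebesgue_measure]_(x in D) (w_ n x)%:E)%E @[n --> \oo] -->
  (\int[lebesgue_measure]_(x in D) (w x)%:E)%E.
Proof.
move=> mD mw_ mw mv cw wv fin.
have v0 x : D x -> 0 <= v x.
  by move=> Dx; have /andP[a b] := wv 0 x Dx; exact: le_trans b.
have iv : lebesgue_measure.-integrable D (EFin \o v).
  apply/integrableP; split; first exact/measurable_EFinP.
  apply: le_lt_trans fin; rewrite le_eqVlt; apply/orP; left; apply/eqP.
  apply: eq_integral => x; rewrite inE => Dx.
  by apply: gee0_abs; rewrite lee_fin; exact: v0.
have [] := @dominated_convergence _ (measurableTypeR R) R lebesgue_measure D mD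
  (fun n => EFin \o w_ n) (EFin \o w) (EFin \o v).
- by move=> n; apply/measurable_EFinP; exact: mw_.
- exact/measurable_EFinP.
- apply: aeW => x Dx; apply: cvg_comp; first exact: cw.
  by apply: cvg_EFin; [exact: nearW|exact: cvg_id].
- exact: iv.
- apply: aeW => x n Dx /=; rewrite lee_fin; have /andP[w0 w1] := wv n x Dx.
  by rewrite ger0_norm.
- by [].
Qed.

Lemma escape_cvg (R : realType) (q : R) (f g : R -> R) (t_ : nat -> R)
    (t0 : R) (w : R -> R) :
  0 < q < 2 -> admissible f g -> 0 < t0 -> (escape_integral q f g t0 < +oo)%E ->
  (forall n, t0 <= t_ n) -> measurable_fun `]0%R : R, +oo[ w ->
  (forall s, 0 < s -> shifted_integrand q f g (t_ n) s @[n --> \oo] --> w s) ->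
  escape_integral q f g (t_ n) @[n --> \oo] -->
    (\int[lebesgue_measure]_(s in `]0%R, +oo[) (w s)%:E)%E.
Proof.
move=> hq hfg t00; rewrite escape_shifted // => fin tn mw cw.
have tn0 n : 0 < t_ n by exact: lt_le_trans (tn n).
have -> : (fun n => escape_integral q f g (t_ n)) =
    (fun n => \int[lebesgue_measure]_(s in `]0%R, +oo[)
                 (shifted_integrand q f g (t_ n) s)%:E)%E.
  by apply/funext => n; exact: (escape_shifted hq hfg (tn0 n)).
apply: (@dominated_EFin _ _ _ _ (shifted_integrand q f g t0)).
- exact: measurable_itv.
- by move=> n; exact: (shifted_measurable hq hfg (tn0 n)).
- exact: mw.
- exact: (shifted_measurable hq hfg t00).
- by move=> x /=; rewrite in_itv /= andbT; exact: cw.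
- move=> n x /=; rewrite in_itv /= andbT => x0.
  by rewrite shifted_ge0 /=; exact: (shifted_anti hq hfg t00 (tn n) x0).
- exact: fin.
Qed.

Lemma shifted_continuous (R : realType) (q : R) (f g : R -> R) (t s : R) :
  0 < q < 2 -> admissible f g -> 0 < t -> 0 < s ->
  {for t, continuous (fun t => shifted_integrand q f g t s)}.
Proof.
move=> hq hfg t0 s0; apply: cvgV.
  by rewrite gt_eqF //; apply: (sqrtF_powG_gt0 _ hfg (ltW t0)); rewrite ltrDl.
apply: (@sqrtF_powG_comp_continuous R q f g (fun t => t + s) id) => //.
  by apply: cvgD; [exact: cvg_id|exact: cvg_cst].
near=> y; rewrite lerDl (ltW s0) andbT; apply: ltW.
near: y; exact: lt_nbhsr.
Unshelve. all: by end_near. Qed.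

Lemma ln_unbounded (R : realType) (x c u : R) : 0 < c -> 0 < u ->
  exists2 v, u <= v & x < c * (ln v - ln u).
Proof.
move=> c0 u0; pose y := ln u + `|x| / c + 1.
have xy : ln u < y by rewrite /y; have : 0 <= `|x| / c by [rewrite divr_ge0 // ltW]; lra.
exists (expR y).
  by rewrite -(lnK u0); rewrite ler_expR ltW.
rewrite expRK /y.
have -> : c * (ln u + `|x| / c + 1 - ln u) = `|x| + c.
  by field; rewrite gt_eqF.
by apply: le_lt_trans (ler_norm x) _; rewrite ltrDl.
Qed.

(** For q <= 1 this follows from integrability alone: if f and g were bounded,
then S(s, 1) would grow at most linearly, because 1 / (2 - q) <= 1, and the
integral would diverge logarithmically. *)
Lemma coefficients_unbounded (R : realType) (q : R) (f g : R -> R) :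
  0 < q < 2 -> admissible f g -> (escape_integral q f g 1 < +oo)%E ->
  (1 < q -> (f t @[t --> +oo] --> +oo) \/ (g t @[t --> +oo] --> +oo)) ->
  (forall B, exists2 t, 0 < t & B <= f t) \/
  (forall B, exists2 t, 0 < t & B <= g t).
Proof.
move=> hq hfg fin hlim; have /andP[q0 q2] := hq.
have [q1|q1] := ltP 1 q.
  have unb (h : R -> R) : h t @[t --> +oo] --> +oo ->
      forall B, exists2 t, 0 < t & B <= h t.
    move=> /cvgryPge hy B; near (+oo : set_system R) => t; exists t.
      by near: t; exact: nbhs_pinfty_gt.
    by near: t; exact: hy.
  by case: (hlim q1) => /unb; [left|right].
apply: contrapT => /not_orP[/existsNP[B1 HB1] /existsNP[B2 HB2]].
have bnd (h : R -> R) B : ~ (exists2 t, 0 < t & B <= h t) ->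
    forall t, 0 < t -> h t <= B.
  move=> H t t0; rewrite leNgt; apply/negP => Bt; apply: H.
  by exists t => //; exact: ltW.
pose B := 1 + `|B1| + `|B2|.
have n1 : 0 <= `|B1| by []. have n2 : 0 <= `|B2| by [].
have B1' : 1 <= B by rewrite /B; lra.
have fB t : 0 < t -> f t <= B.
  by move=> /(bnd _ _ HB1) h; have := ler_norm B1; rewrite /B; lra.
have gB t : 0 < t -> g t <= B.
  by move=> /(bnd _ _ HB2) h; have := ler_norm B2; rewrite /B; lra.
have [[cf cg] [mf mg] _ _ _] := hfg.
have Sub s : 2 <= s -> sqrtF_powG q f g s 1 <= (B + B) * s.
  move=> s2; have s1 : 1 <= s by lra.
  have Bs : 1 <= B * s by rewrite (le_trans B1') // ler_peMr //; lra.
  have inc (h : R -> R) : continuous h -> {homo h : x y / x <= y} ->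
      (forall t, 0 < t -> h t <= B) -> primitive h s - primitive h 1 <= B * s.
    move=> ch mh hB; have /andP[_] := primitiveB_itv ch mh s1.
    move/le_trans; apply; apply: (@le_trans _ _ (B * (s - 1))).
      by rewrite ler_wpM2r ?hB ?subr_ge0 //; lra.
    by rewrite ler_wpM2l //; lra.
  rewrite mulrDl; apply: lerD.
    apply: (@le_trans _ _ (Num.sqrt ((B * s) ^+ 2))).
      rewrite ler_wsqrtr // (le_trans (inc _ cf mf fB)) //.
      by rewrite expr2 ler_peMr //; lra.
    by rewrite sqrtr_sqr ger0_norm //; lra.
  apply: (@le_trans _ _ ((B * s) `^ (2 - q)^-1)).
    apply: le_powR; rewrite ?invr_gt0 ?subr_gt0 ?inc //.
    exact: (admissible_ge0 hfg).
  by apply: ler1_powR => //; rewrite invf_le1; lra.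
have c0 : 0 < (B + B)^-1 by rewrite invr_gt0; lra.
move: fin (escape_ge0 q f g 1) => /[swap] t0 fin.
case E : (escape_integral q f g 1) fin => [x| |] // _; last by rewrite E in t0.
have [//|v v2 xv] := @ln_unbounded _ x (B + B)^-1 2 c0.
have : (((B + B)^-1 * (ln v - ln 2))%:E <= x%:E)%E.
  rewrite -E; apply: escape_ge_ln => //; [lra..|].
  by move=> s /andP[s2 _]; exact: Sub.
by rewrite lee_fin leNgt xv.
Unshelve. all: by end_near. Qed.

Lemma shifted_to0 (R : realType) (q : R) (f g : R -> R) (s e : R) :
  0 < q < 2 -> admissible f g ->
  (forall B, exists2 t, 0 < t & B <= f t) \/
  (forall B, exists2 t, 0 < t & B <= g t) ->
  0 < s -> 0 < e -> exists2 t, 0 < t & shifted_integrand q f g t s <= e.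
Proof.
move=> hq hfg unb s0 e0; have /andP[q0 q2] := hq; have q2' : 0 < 2 - q by rewrite subr_gt0.
have [[cf cg] [mf mg] _ _ _] := hfg.
suff [t t0 Ht] : exists2 t, 0 < t & e^-1 <= sqrtF_powG q f g (t + s) t.
  exists t => //; rewrite /shifted_integrand -[leRHS]invrK lef_pV2 ?posrE //.
    by apply: (sqrtF_powG_gt0 _ hfg (ltW t0)); rewrite ltrDl.
  by rewrite invr_gt0.
have inc (h : R -> R) t : continuous h -> {homo h : x y / x <= y} ->
    h t * s <= primitive h (t + s) - primitive h t.
  move=> ch mh; have tts : t <= t + s by rewrite lerDl ltW.
  have /andP[+ _] := primitiveB_itv ch mh tts.
  by rewrite addrAC subrr add0r.
case: unb => [/(_ ((e^-1) ^+ 2 / s))|/(_ (e^-1 `^ (2 - q) / s))] [t t0 Bt].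
- exists t => //; rewrite /sqrtF_powG.
  apply: ler_wpDr; first exact: powR_ge0.
  apply: (@le_trans _ _ (Num.sqrt (e^-1 ^+ 2))).
    by rewrite sqrtr_sqr ler_norm.
  rewrite ler_wsqrtr // (le_trans _ (inc f t cf mf)) //.
  by rewrite -ler_pdivrMr.
- exists t => //; rewrite /sqrtF_powG.
  apply: ler_wpDl; first exact: sqrtr_ge0.
  apply: (@le_trans _ _ ((e^-1 `^ (2 - q)) `^ (2 - q)^-1)).
    by rewrite -powRrM mulfV ?gt_eqF // powRr1 // invr_ge0 ltW.
  apply: le_powR; rewrite ?invr_gt0 ?powR_ge0 //.
  rewrite (le_trans _ (inc g t cg mg)) //.
  by rewrite -ler_pdivrMr.
Qed.

Lemma escape_to0 (R : realType) (q : R) (f g : R -> R) :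
  0 < q < 2 -> admissible f g -> (escape_integral q f g 1 < +oo)%E ->
  (forall B, exists2 t, 0 < t & B <= f t) \/
  (forall B, exists2 t, 0 < t & B <= g t) ->
  escape_integral q f g (1 + n%:R) @[n --> \oo] --> 0%E.
Proof.
move=> hq hfg fin unb.
have := @escape_cvg R q f g (fun n => 1 + n%:R) 1 (cst 0) hq hfg ltr01 fin.
rewrite integral0; apply.
- by move=> n; rewrite lerDl.
- exact: measurable_cst.
- move=> s s0; apply/cvgrPdist_le => e e0.
  have [t t0 Ht] := shifted_to0 hq hfg unb s0 e0.
  near=> n; rewrite sub0r normrN (ger0_norm (shifted_ge0 _ _ _ _ _)).
  apply: le_trans Ht; apply: (shifted_anti hq hfg t0 _ s0).
  apply: (@le_trans _ _ n%:R); last by rewrite lerDr ler01.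
  by near: n; exact: nbhs_infty_ger.
Unshelve. all: by end_near. Qed.

(** The escape integral is nonincreasing; dominated convergence makes it
continuous along sequences, so the value d is attained at the supremum of the
points where the integral is at least d. *)
Lemma escape_surjective (R : realType) (q : R) (f g : R -> R) (d : R) :
  0 < q < 2 -> admissible f g ->
  (forall t, 0 < t -> (escape_integral q f g t < +oo)%E) ->
  escape_integral q f g (1 + n%:R) @[n --> \oo] --> 0%E ->
  (exists2 t, 0 < t & (d%:E <= escape_integral q f g t)%E) -> 0 < d ->
  exists2 a, 0 < a & escape_integral q f g a = d%:E.
Proof.
move=> hq hfg fin t0 [t1 t10 Ht1] d0.
pose A := [set t : R | 0 < t /\ (d%:E <= escape_integral q f g t)%E].
have [n Hn] : exists n : nat, (escape_integral q f g (1 + n%:R) < d%:E)%E.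
  apply: contrapT => /forallNP H.
  have : (d%:E <= 0)%E.
    apply: cvge_ge t0; apply: nearW => n.
    by rewrite leNgt; apply/negP; exact: H.
  by rewrite lee_fin leNgt d0.
have n0 : 0 < 1 + n%:R :> R by rewrite ltr_pwDl.
have Aub : ubound A (1 + n%:R).
  move=> t [t0' Ht]; rewrite leNgt; apply/negP => nt.
  have := le_lt_trans (le_trans Ht (escape_le hq hfg n0 (ltW nt))) Hn.
  by rewrite ltxx.
have Asup : has_sup A by split; [exists t1|exists (1 + n%:R)].
pose a := sup A.
have a0 : 0 < a by apply: (lt_le_trans t10); apply: ub_le_sup; [case: Asup|].
have lim_esc (t_ : nat -> R) : (forall n, a / 2 <= t_ n) -> t_ n @[n --> \oo] --> a ->
    escape_integral q f g (t_ n) @[n --> \oo] --> escape_integral q f g a.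
  move=> h1 h2; have a2 : 0 < a / 2 by rewrite divr_gt0.
  rewrite (escape_shifted hq hfg a0).
  apply: (escape_cvg hq hfg a2 (fin _ a2) h1 (shifted_measurable hq hfg a0)).
  move=> s s0.
  have cs := @shifted_continuous R q f g a s hq hfg a0 s0.
  by have := continuous_cvg _ cs h2; exact.
have cinv : (n.+1%:R^-1 : R) @[n --> \oo] --> (0 : R).
  exact: cvg_harmonic.
exists a => //; apply/eqP; rewrite eq_le; apply/andP; split.
- have /lim_esc H : (a + m.+1%:R^-1) @[m --> \oo] --> a.
    by rewrite -[X in _ --> X]addr0; apply: cvgD; [exact: cvg_cst|].
  have {}H := H (fun m => ltac:(by rewrite ler_wpDr ?invr_ge0 //; lra)).
  apply: cvge_le H; apply: nearW => m; rewrite leNgt; apply/negP => /ltW Hm.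
  have am : a < a + m.+1%:R^-1 by rewrite ltrDl invr_gt0.
  have : a + m.+1%:R^-1 <= a.
    by apply: ub_le_sup; [case: Asup|split => //; exact: lt_trans am].
  by rewrite leNgt am.
- pose t_ (m : nat) := a - a / 2 * m.+1%:R^-1.
  have t_a m : t_ m < a.
    by rewrite /t_ ltrBlDr ltrDl mulr_gt0 ?invr_gt0 // divr_gt0.
  have a2t m : a / 2 <= t_ m.
    rewrite /t_; have : a / 2 * m.+1%:R^-1 <= a / 2 * 1.
      by rewrite ler_wpM2l ?divr_ge0 ?(ltW a0) // invf_le1 // ler1n.
    by move: (a / 2 * m.+1%:R^-1) => z; lra.
  have ct : t_ m @[m --> \oo] --> a.
    rewrite -[X in _ --> X](subr0 a) -(mulr0 (a / 2)).
    by apply: cvgB; [exact: cvg_cst|apply: cvgMr].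
  have H := lim_esc _ a2t ct.
  apply: cvge_ge H; apply: nearW => m.
  have at_gt0 : 0 < a - t_ m by rewrite subr_gt0; exact: t_a.
  have [t [t0' Ht] tt] := sup_adherent at_gt0 Asup.
  apply: (le_trans Ht); apply: (escape_le hq hfg) => //.
    by apply: lt_le_trans (a2t m); rewrite divr_gt0.
  by move: tt; rewrite -/a subKr; exact: ltW.
Qed.

(** By the hypothesis on h, h(s) <= h(1) / mu =: H for s <= 1. As F(s) - F(t)
<= s f(s) and G(s) - G(t) <= s g(s), this yields S(s, t) <= s h(s) <= H s, so
the integral diverges logarithmically as t tends to 0. *)
Lemma escape_at0 (R : realType) (q mu A : R) (f g : R -> R) :
  0 < q < 2 -> admissible f g -> 0 < mu ->
  (forall s t, 0 < t -> t <= s -> mu * hfun q f g t <= hfun q f g s) ->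
  \forall t \near 0^'+, (A%:E <= escape_integral q f g t)%E.
Proof.
move=> hq hfg mu0 hh; have /andP[q0 q2] := hq; have q2' : 0 < 2 - q by rewrite subr_gt0.
have [[cf cg] [mf mg] fpos _ gpos] := hfg.
pose H := hfun q f g 1 / mu.
have h1 : 0 < hfun q f g 1.
  apply: ltr_wpDr; first exact: powR_ge0.
  by apply: powR_gt0; rewrite divr1; case: (fpos 1 ltr01).
have H0 : 0 < H by rewrite divr_gt0.
have Sub s t : 0 < t -> t <= s -> s <= 1 -> sqrtF_powG q f g s t <= H * s.
  move=> t0 ts s1; have s0 : 0 < s by exact: lt_le_trans ts.
  have hH : hfun q f g s <= H by rewrite ler_pdivlMr // mulrC hh.
  have inc (h : R -> R) : continuous h -> {homo h : x y / x <= y} -> 0 <= h s ->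
      primitive h s - primitive h t <= h s * s.
    move=> ch mh hs; have /andP[_] := primitiveB_itv ch mh ts.
    by move/le_trans; apply; rewrite ler_wpM2l // lerBlDr lerDl ltW.
  have fs : 0 <= f s by apply: (admissible_f_ge0 hfg); exact: ltW.
  have gs : 0 <= g s by apply: (admissible_g_ge0 hfg); exact: ltW.
  apply: (@le_trans _ _ (hfun q f g s * s)); last by rewrite ler_wpM2r // ltW.
  rewrite /hfun mulrDl; apply: lerD.
    rewrite powR12_sqrt ?divr_ge0 ?(ltW s0) //.
    rewrite -[X in _ * X](ger0_norm (ltW s0)) -sqrtr_sqr -sqrtrM ?divr_ge0 ?(ltW s0) //.
    rewrite ler_wsqrtr // (le_trans (inc _ cf mf fs)) //.
    by rewrite expr2 mulrA divfK // gt_eqF.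
  have -> : (g s / s `^ (1 - q)) `^ (2 - q)^-1 * s = (g s * s) `^ (2 - q)^-1.
    have sE : s = (s `^ (2 - q)) `^ (2 - q)^-1.
      by rewrite -powRrM mulfV ?gt_eqF // powRr1 // ltW.
    rewrite [X in _ * X]sE -powRM ?divr_ge0 ?powR_ge0 //; congr (_ `^ _).
    have sq : s `^ (2 - q) = s `^ (1 - q) * s.
      have -> : 2 - q = 1 - q + 1 by ring.
      rewrite powRD; last by apply/implyP => _; rewrite gt_eqF.
      by rewrite (powRr1 (ltW s0)).
    have sq0 : s `^ (1 - q) != 0 by rewrite gt_eqF // powR_gt0.
    by rewrite sq mulrA divfK.
  apply: le_powR; rewrite ?invr_gt0 //; last exact: inc.
  by apply: (admissible_ge0 hfg) => //; exact: ltW.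
pose e := expR (- (H * A)) / 2.
have e0 : 0 < e by rewrite divr_gt0 // expR_gt0.
near=> t.
have t0 : 0 < t by near: t; exact: nbhs_right_gt.
have te : t <= e by apply: ltW; near: t; exact: nbhs_right_lt.
have t1 : t <= 1 / 2 by apply: ltW; near: t; apply: nbhs_right_lt; lra.
have t20 : 0 < 2 * t by lra.
apply: (@le_trans _ _ (H^-1 * (ln 1 - ln (2 * t)))%:E).
  rewrite lee_fin ln1 sub0r ler_pdivlMl //.
  suff : ln (2 * t) <= - (H * A) by lra.
  rewrite -ler_expR lnK //; move: te; rewrite /e; lra.
apply: (escape_ge_ln hq hfg (ltW t0) _ _ H0); [lra|lra|].
by move=> s /andP[s2 s1]; apply: Sub => //; lra.
Unshelve. all: by end_near. Qed.

(** * Radial test functions *)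

Lemma dotpC (R : realType) n (x y : 'rV[R]_n) : dotp x y = dotp y x.
Proof. by apply: eq_bigr => i _; rewrite mulrC. Qed.

Lemma dotpZl (R : realType) n (a : R) (x y : 'rV[R]_n) :
  dotp (a *: x) y = a * dotp x y.
Proof. by rewrite /dotp mulr_sumr; apply: eq_bigr => i _; rewrite mxE mulrA. Qed.

Lemma dotpDl (R : realType) n (x y z : 'rV[R]_n) :
  dotp (x + y) z = dotp x z + dotp y z.
Proof. by rewrite /dotp -big_split; apply: eq_bigr => i _; rewrite mxE mulrDl. Qed.

Lemma dotp_ge0 (R : realType) n (x : 'rV[R]_n) : 0 <= dotp x x.
Proof. by apply: sumr_ge0 => i _; rewrite -expr2 sqr_ge0. Qed.

Lemma dotp_delta (R : realType) n (x : 'rV[R]_n) (i : 'I_n) :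
  dotp x (delta_mx 0 i) = x 0 i.
Proof.
rewrite /dotp (bigD1 i) //= !mxE !eqxx mulr1 big1 ?addr0 // => j ji.
by rewrite mxE (negbTE ji) andbF mulr0.
Qed.

Lemma dotp_eq0 (R : realType) n (x : 'rV[R]_n) : dotp x x = 0 -> x = 0.
Proof.
move=> x0; apply/matrixP => i j; rewrite mxE (ord1 i).
have := x0; rewrite /dotp => /eqP; rewrite psumr_eq0; last first.
  by move=> k _; rewrite -expr2 sqr_ge0.
by move=> /allP /(_ j (mem_index_enum _)) /=; rewrite mulf_eq0 orbb => /eqP.
Qed.

Lemma sqr_enorm (R : realType) n (x : 'rV[R]_n) : enorm x ^+ 2 = dotp x x.
Proof. by rewrite sqr_sqrtr // dotp_ge0. Qed.

Lemma enorm_ge0 (R : realType) n (x : 'rV[R]_n) : 0 <= enorm x.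
Proof. exact: sqrtr_ge0. Qed.

Lemma enormZ (R : realType) n (a : R) (x : 'rV[R]_n) :
  enorm (a *: x) = `|a| * enorm x.
Proof.
rewrite /enorm dotpZl dotpC dotpZl mulrA -expr2 sqrtrM ?sqr_ge0 //.
by rewrite sqrtr_sqr.
Qed.

Lemma coord_is_derive (R : realType) n (x v : 'rV[R]_n) (i : 'I_n) :
  is_derive x v (fun y : 'rV[R]_n => y 0 i) (v 0 i).
Proof.
have did := @derivable_id R 'rV[R]_n x v.
have /derivable_mxP di := did.
apply: DeriveDef; first exact: (di 0 i).
have := @derive_mx R 'rV[R]_n 1 n id x v did.
by rewrite derive_id => /matrixP /(_ 0 i); rewrite mxE => <-.
Qed.

Lemma continuous_add (R : realType) (T : topologicalType) (h k : T -> R) :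
  continuous h -> continuous k -> continuous (fun x => h x + k x).
Proof. by move=> ch ck x; apply: cvgD; [exact: ch|exact: ck]. Qed.

Lemma continuous_mul (R : realType) (T : topologicalType) (h k : T -> R) :
  continuous h -> continuous k -> continuous (fun x => h x * k x).
Proof. by move=> ch ck x; apply: cvgM; [exact: ch|exact: ck]. Qed.

Lemma continuous_const (R : realType) (T : topologicalType) (a : R) :
  continuous (fun _ : T => a).
Proof. by move=> x; exact: cvg_cst. Qed.

Lemma near_everywhere (T : topologicalType) (P : T -> Prop) (x : T) :
  (forall y, P y) -> \forall y \near x, P y.
Proof. by move=> HP; apply: nearW. Qed.

Section radial_test_function.
Variables (R : realType) (n : nat) (c : 'rV[R]_n) (A B D s0 : R).

Definition sqdist (x : 'rV[R]_n) : R := dotp (x - c) (x - c).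

(** A polynomial in the squared distance to c: it is smooth also at c, where
the distance itself is not. *)
Definition radial_quadratic (x : 'rV[R]_n) : R :=
  A + B * (sqdist x - s0) + D * (sqdist x - s0) ^+ 2.

Let slope (x : 'rV[R]_n) : R := B + 2 * D * (sqdist x - s0).

Lemma centered_coord_is_derive (x v : 'rV[R]_n) (i : 'I_n) :
  is_derive x v (fun y : 'rV[R]_n => (y - c) 0 i) (v 0 i).
Proof.
have -> : (fun y : 'rV[R]_n => (y - c) 0 i) =
    (fun y : 'rV[R]_n => y 0 i) - cst (c 0 i).
  by apply/funext => y; rewrite !mxE.
have := is_deriveB (coord_is_derive x v i) (is_derive_cst (c 0 i) x v).
by rewrite subr0.
Qed.

Lemma sqdist_is_derive (x v : 'rV[R]_n) :
  is_derive x v sqdist (2 * dotp (x - c) v).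
Proof.
have -> : sqdist = \sum_(i < n)
    ((fun y : 'rV[R]_n => (y - c) 0 i) * (fun y : 'rV[R]_n => (y - c) 0 i)).
  by apply/funext => y; rewrite fct_sumE.
have -> : 2 * dotp (x - c) v =
    \sum_(i < n) ((x - c) 0 i *: v 0 i + (x - c) 0 i *: v 0 i).
  rewrite /dotp mulr_sumr; apply: eq_bigr => i _.
  by rewrite /GRing.scale /=; ring.
apply: is_derive_sum => i.
exact: (is_deriveM (centered_coord_is_derive x v i) (centered_coord_is_derive x v i)).
Qed.

Lemma slope_is_derive (x v : 'rV[R]_n) :
  is_derive x v slope (4 * D * dotp (x - c) v).
Proof.
have -> : slope = cst B + (2 * D) \*: (sqdist - cst s0) by [].
have := sqdist_is_derive x v => h.
by apply: is_derive_eq; rewrite /GRing.scale /=; ring.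
Qed.

Lemma radial_quadratic_is_derive (x v : 'rV[R]_n) :
  is_derive x v radial_quadratic (2 * slope x * dotp (x - c) v).
Proof.
have -> : radial_quadratic = cst A + B \*: (sqdist - cst s0) +
    D \*: ((sqdist - cst s0) * (sqdist - cst s0)).
  by apply/funext => y; rewrite /radial_quadratic !fctE /= expr2.
have := sqdist_is_derive x v => h.
apply: is_derive_eq; rewrite /slope !fctE /GRing.scale /=; ring.
Qed.

Lemma partial_radial_quadratic (i : 'I_n) :
  partial i radial_quadratic = (fun x => 2 * slope x * (x - c) 0 i).
Proof.
apply/funext => x; rewrite /partial.
by have [_ ->] := radial_quadratic_is_derive x (delta_mx 0 i); rewrite dotp_delta.
Qed.

Lemma partial_radial_quadratic_is_derive (i j : 'I_n) (x : 'rV[R]_n) :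
  is_derive x (delta_mx 0 j) (partial i radial_quadratic)
    (8 * D * (x - c) 0 i * (x - c) 0 j + 2 * slope x * (i == j)%:R).
Proof.
rewrite partial_radial_quadratic.
have -> : (fun x => 2 * slope x * (x - c) 0 i) =
    2 \*: (slope * (fun y : 'rV[R]_n => (y - c) 0 i)).
  by apply/funext => y; rewrite !fctE /= /GRing.scale /= mulrA.
have h1 := slope_is_derive x (delta_mx 0 j).
have h2 := centered_coord_is_derive x (delta_mx 0 j) i.
apply: is_derive_eq; rewrite dotp_delta /GRing.scale /= [_ 0 i in X in _ * X]mxE eqxx /=.
by ring.
Qed.

Lemma partial2_radial_quadratic (i j : 'I_n) :
  partial j (partial i radial_quadratic) =
  (fun x => 8 * D * (x - c) 0 i * (x - c) 0 j + 2 * slope x * (i == j)%:R).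
Proof.
apply/funext => z.
transitivity ('D_(delta_mx 0 j) (partial i radial_quadratic) z); first by [].
by have [_ ->] := partial_radial_quadratic_is_derive i j z.
Qed.

Lemma centered_coord_continuous (i : 'I_n) :
  continuous (fun y : 'rV[R]_n => (y - c) 0 i).
Proof.
have -> : (fun y : 'rV[R]_n => (y - c) 0 i) =
    (fun y : 'rV[R]_n => y 0 i + - c 0 i).
  by apply/funext => y; rewrite !mxE.
apply: continuous_add; last exact: continuous_const.
exact: (@coord_continuous R 1 n 0 i).
Qed.

Lemma sqdist_continuous : continuous sqdist.
Proof.
apply: continuous_big => [|i _].
  by move=> x; apply: add_continuous.
by apply: continuous_mul; exact: centered_coord_continuous.
Qed.

Lemma slope_continuous : continuous slope.
Proof.
apply: continuous_add; first exact: continuous_const.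
apply: continuous_mul; first exact: continuous_const.
apply: continuous_add; [exact: sqdist_continuous|exact: continuous_const].
Qed.

Lemma radial_quadratic_continuous : continuous radial_quadratic.
Proof.
have cs : continuous (fun x => sqdist x - s0).
  by apply: continuous_add; [exact: sqdist_continuous|exact: continuous_const].
have -> : radial_quadratic = (fun x => A + B * (sqdist x - s0) +
    D * ((sqdist x - s0) * (sqdist x - s0))).
  by apply/funext => x; rewrite /radial_quadratic expr2.
apply: continuous_add.
  apply: continuous_add; first exact: continuous_const.
  by apply: continuous_mul => //; exact: continuous_const.
by apply: continuous_mul; [exact: continuous_const|exact: continuous_mul].
Qed.

Lemma radial_quadratic_C2 (x : 'rV[R]_n) : C2_near radial_quadratic x.
Proof.
apply: near_everywhere => y; split.
- exact: radial_quadratic_continuous.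
- move=> i; split; first by have [] := radial_quadratic_is_derive y (delta_mx 0 i).
  rewrite partial_radial_quadratic.
  apply: continuous_mul; last exact: centered_coord_continuous.
  by apply: continuous_mul; [exact: continuous_const|exact: slope_continuous].
- move=> i j; split; first by have [] := partial_radial_quadratic_is_derive i j y.
  rewrite partial2_radial_quadratic.
  apply: continuous_add.
    apply: continuous_mul; last exact: centered_coord_continuous.
    by apply: continuous_mul; [exact: continuous_const|exact: centered_coord_continuous].
  apply: continuous_mul; last exact: continuous_const.
  by apply: continuous_mul; [exact: continuous_const|exact: slope_continuous].
Qed.

Lemma grad_radial_quadratic (x : 'rV[R]_n) : sqdist x = s0 ->
  grad radial_quadratic x = (2 * B) *: (x - c).
Proof.
move=> xs; apply/rowP => i; rewrite !mxE partial_radial_quadratic !mxE /slope xs.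
by rewrite subrr mulr0 addr0.
Qed.

Lemma hess_radial_quadratic (x e : 'rV[R]_n) : sqdist x = s0 ->
  dotp (e *m hess radial_quadratic x) e =
  8 * D * dotp e (x - c) ^+ 2 + 2 * B * dotp e e.
Proof.
move=> xs.
have -> : e *m hess radial_quadratic x =
    (8 * D * dotp e (x - c)) *: (x - c) + (2 * B) *: e.
  apply/rowP => j; rewrite mxE [RHS]mxE [X in _ = X + _]mxE [X in _ = _ + X]mxE.
  transitivity (\sum_(i < n) (8 * D * (x - c) 0 j * (e 0 i * (x - c) 0 i)
      + 2 * B * (e 0 i * (i == j)%:R))).
    apply: eq_bigr => i _; rewrite mxE.
    rewrite partial2_radial_quadratic.
    by rewrite /slope xs; ring.
  rewrite big_split /= -!mulr_sumr -/(dotp e (x - c)).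
  have -> : \sum_(i < n) e 0 i * (i == j)%:R = e 0 j.
    rewrite (bigD1 j) //= eqxx mulr1 big1 ?addr0 // => i ij.
    by rewrite (negbTE ij) mulr0.
  by ring.
by rewrite dotpDl !dotpZl (dotpC (x - c)); ring.
Qed.

(** In the degenerate case an upper bound of the supremum is enough. *)
Lemma inf_laplacian_plus_radial_center : s0 = 0 -> 0 <= B ->
  inf_laplacian_plus radial_quadratic c <= 2 * B.
Proof.
move=> s00 B0.
have cs : sqdist c = s0.
  by rewrite s00 /sqdist subrr /dotp big1 // => i _; rewrite !mxE mulr0.
rewrite /inf_laplacian_plus grad_radial_quadratic // subrr scaler0 eqxx.
set E := (X in sup X).
have Eub e : E e -> e <= 2 * B.
  move=> [v /= v1 <-]; rewrite hess_radial_quadratic // subrr -sqr_enorm v1.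
  have -> : dotp v 0 = 0 by rewrite /dotp big1 // => i _; rewrite mxE mulr0.
  by rewrite expr0n mulr0 add0r expr1n mulr1.
have [->|/set0P E0] := eqVneq E set0; first by rewrite sup0 mulr_ge0.
exact: ge_sup.
Qed.

Lemma inf_laplacian_plus_radial (x : 'rV[R]_n) : sqdist x = s0 -> 0 < s0 ->
  0 < B -> inf_laplacian_plus radial_quadratic x = 2 * B + 8 * D * s0.
Proof.
move=> xs s00 B0; rewrite /inf_laplacian_plus grad_radial_quadratic //.
have xc : dotp (x - c) (x - c) = s0 by [].
have B2 : 2 * B != 0 by rewrite gt_eqF // mulr_gt0.
case: ifPn => [/eqP /(congr1 (fun v => dotp v (x - c)))|_].
  rewrite dotpZl xc /dotp big1; last by move=> i _; rewrite mxE mul0r.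
  by move=> /eqP; rewrite mulf_eq0 (negbTE B2) gt_eqF.
rewrite hess_radial_quadratic // sqr_enorm !dotpZl (dotpC (x - c) ((2 * B) *: _)).
rewrite dotpZl xc; field.
by rewrite !gt_eqF.
Qed.

End radial_test_function.

(** * Upper-semicontinuous functions and Euclidean geometry *)

(** The superlevel sets in K form a proper filter base, and any cluster point
of it is a maximum point. *)
Lemma usc_attains_max (R : realType) (T : topologicalType) (K : set T)
    (u : T -> R) : compact K -> K !=set0 -> usc_on K u ->
  exists2 z, K z & forall y, K y -> u y <= u z.
Proof.
move=> cK [k Kk] uscu.
pose B y := K `&` [set x | u y <= u x].
have FF : ProperFilter (filter_from K B).
  apply: filter_from_proper; last by move=> y Ky; exists y; split => //=.
  apply: filter_from_filter; first by exists k.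
  move=> y1 y2 K1 K2; have [le|/ltW le] := leP (u y1) (u y2).
    by exists y2 => // x [Kx /= h]; split; split=> //=; exact: le_trans h.
  by exists y1 => // x [Kx /= h]; split; split=> //=; exact: le_trans h.
have FK : filter_from K B K by exists k => // x [].
have [z [Kz cz]] := cK _ FF FK.
exists z => // y Ky; rewrite leNgt; apply/negP => /(uscu z Kz).
rewrite near_withinE => nz.
have FB : filter_from K B (B y) by exists y.
have [w [[Kw /= yw] /(_ Kw)]] := cz _ _ FB nz.
by rewrite ltNge yw.
Qed.

Lemma usc_on_sub (R : realType) (T : topologicalType) (A K : set T) (u : T -> R) :
  K `<=` A -> usc_on A u -> usc_on K u.
Proof.
move=> KA uscu x Kx a ua; have := uscu x (KA _ Kx) a ua.
by rewrite !near_withinE; apply: filterS => y h Ky; apply: h; exact: KA.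
Qed.

Lemma usc_on_sub_continuous (R : realType) (T : topologicalType) (K : set T)
    (u v : T -> R) : usc_on K u -> continuous v -> usc_on K (fun y => u y - v y).
Proof.
move=> uscu cv x Kx a ua.
pose e := (a - (u x - v x)) / 2.
have e0 : 0 < e by rewrite divr_gt0 // subr_gt0.
have h1 := uscu x Kx (u x + e) (ltac:(by rewrite ltrDl)).
have h2 : \forall y \near x, v x - e < v y.
  by apply: (cvgr_gt (v x) (cv x)); rewrite ltrBlDr ltrDl.
move: h1; rewrite !near_withinE => h1.
near=> y => Ky.
have h3 : u y < u x + e by apply: (near h1 y).
have h4 : v x - e < v y by near: y.
by rewrite /e in h3 h4; lra.
Unshelve. all: by end_near. Qed.

Lemma coord_le_enorm (R : realType) n (v : 'rV[R]_n) (i : 'I_n) :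
  `|v 0 i| <= enorm v.
Proof.
rewrite -sqrtr_sqr ler_wsqrtr // /dotp (bigD1 i) //= expr2 lerDl.
by apply: sumr_ge0 => j _; rewrite -expr2 sqr_ge0.
Qed.

Lemma norm_le_enorm (R : realType) n (v : 'rV[R]_n) : `|v| <= enorm v.
Proof.
rewrite /Num.Def.normr /= mx_normrE.
apply: bigmax_le; first exact: enorm_ge0.
by move=> [i j] _ /=; rewrite (ord1 i); exact: coord_le_enorm.
Qed.

Lemma enormN (R : realType) n (v : 'rV[R]_n) : enorm (- v) = enorm v.
Proof. by rewrite -scaleN1r enormZ normrN1 mul1r. Qed.

Lemma sqdistE (R : realType) n (c y : 'rV[R]_n) :
  sqdist c y = enorm (y - c) ^+ 2.
Proof. by rewrite sqr_enorm. Qed.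

Lemma dist_continuous (R : realType) n (c : 'rV[R]_n) :
  continuous (fun y : 'rV[R]_n => enorm (y - c)).
Proof.
move=> y; apply: (@continuous_comp _ _ _ (sqdist c) Num.sqrt).
  exact: sqdist_continuous.
exact: sqrt_continuous.
Qed.

Lemma closed_ball_compact (R : realType) n (c : 'rV[R]_n) (r : R) :
  compact [set y : 'rV[R]_n | enorm (y - c) <= r].
Proof.
apply: bounded_closed_compact.
  exists (r + `|c|); split; first exact: num_real.
  move=> M rM y /= yr; apply: (le_trans _ (ltW rM)).
  rewrite -[y](subrK c); apply: (le_trans (ler_normD _ _)).
  by rewrite lerD2r; apply: le_trans yr; exact: norm_le_enorm.
have -> : [set y : 'rV[R]_n | enorm (y - c) <= r] =
    (fun y : 'rV[R]_n => enorm (y - c)) @^-1` [set x | x <= r] by [].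
apply: closed_comp; last exact: closed_le.
by move=> y _; exact: dist_continuous.
Qed.

Lemma bdist_le (R : realType) n (Omega : set 'rV[R]_n) (x y : 'rV[R]_n) :
  boundary Omega y -> bdist Omega x <= enorm (x - y).
Proof.
move=> by_; apply: ge_inf; last by exists y.
by exists 0 => _ [z _ <-]; exact: enorm_ge0.
Qed.

Lemma bdist_gt0 (R : realType) n (Omega : set 'rV[R]_n) (x : 'rV[R]_n) :
  open Omega -> boundary Omega !=set0 -> Omega x -> 0 < bdist Omega x.
Proof.
move=> oO [y0 hy0] Ox.
have /nbhs_ballP[e /= e0 he] : nbhs x Omega by exact: open_nbhs_nbhs.
apply: (lt_le_trans e0); apply: lb_le_inf; first by exists (enorm (x - y0)), y0.
move=> _ [y [_ nO] <-]; apply: le_trans (norm_le_enorm _).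
rewrite leNgt; apply/negP => xy; apply: nO.
have Oy : Omega y by apply: he; rewrite -ball_normE.
exact: open_nbhs_nbhs.
Qed.

(** Otherwise the segment from x to y would leave Omega, and its first point
outside Omega would be a boundary point at distance less than bdist from x. *)
Lemma near_bdist_in (R : realType) n (Omega : set 'rV[R]_n) (x y : 'rV[R]_n) :
  open Omega -> Omega x -> enorm (y - x) < bdist Omega x -> Omega y.
Proof.
move=> oO Ox yd; apply: contrapT => nOy.
pose p (t : R) : 'rV[R]_n := x + t *: (y - x).
have cp : continuous p.
  move=> t; apply: cvgD; first exact: cvg_cst.
  by apply: cvgZl; exact: cvg_id.
pose B := [set t : R | 0 <= t <= 1 /\ ~ Omega (p t)].
have B1 : B 1 by split; [rewrite ler01 lexx|rewrite /p scale1r addrC subrK].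
have Blb : lbound B 0 by move=> t [/andP[]].
have Bhlb : has_lbound B by exists 0.
pose tau := inf B.
have tau0 : 0 <= tau by apply: lb_le_inf => //; exists 1.
have tau1 : tau <= 1 by apply: ge_inf.
have before t : 0 <= t -> t < tau -> Omega (p t).
  move=> t0 tt; apply: contrapT => nO; have : tau <= t.
    by apply: ge_inf => //; split=> //; rewrite t0 (le_trans (ltW tt)).
  by rewrite leNgt tt.
have nOtau : ~ Omega (p tau).
  move=> Op.
  have : \forall t \near tau, Omega (p t).
    by apply: (cp tau); exact: open_nbhs_nbhs.
  move=> /nbhs_ballP[e /= e0 he].
  have : tau + e <= tau.
    apply: lb_le_inf; first by exists 1.
    move=> t Bt; have tt : tau <= t by exact: ge_inf.
    rewrite leNgt; apply/negP => te; case: (Bt) => _; apply.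
    by apply: he; rewrite /ball /= ltr_distlC; apply/andP; split; lra.
  by rewrite gerDl leNgt e0.
have tau_gt0 : 0 < tau.
  rewrite lt_neqAle tau0 andbT; apply/eqP => t0; apply: nOtau.
  by rewrite -t0 /p scale0r addr0.
have bp : boundary Omega (p tau).
  split; last by move=> /interior_subset.
  move=> V /(cp tau) /nbhs_ballP[e /= e0 he].
  pose t := Num.max 0 (tau - e / 2).
  have tt : t < tau by rewrite gt_max tau_gt0 /=; lra.
  have t0 : 0 <= t by rewrite le_max lexx.
  have t2 : tau - e / 2 <= t by rewrite le_max lexx orbT.
  exists (p t); split; first exact: before.
  by apply: he; rewrite /ball /= ltr_distlC; apply/andP; split; lra.
have := bdist_le x bp; rewrite /p opprD addrA subrr add0r enormN enormZ ger0_norm //.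
rewrite leNgt => /negP; apply; apply: le_lt_trans yd.
by rewrite ler_piMl // enorm_ge0.
Qed.

(** * Barriers touched by test functions *)

(** A strict bound at r0 holds in a neighbourhood by continuity, and can be
integrated twice. *)
Lemma taylor2_le (R : realType) (phi phi1 phi2 : R -> R) (r0 c : R) :
  (forall r : R, is_derive r 1 phi (phi1 r)) ->
  (forall r : R, is_derive r 1 phi1 (phi2 r)) -> continuous phi2 ->
  phi2 r0 < c ->
  \forall r \near r0,
    phi r <= phi r0 + phi1 r0 * (r - r0) + c / 2 * (r - r0) ^+ 2.
Proof.
move=> d1 d2 c2 lt.
have /nbhs_ballP[e /= e0 he] : \forall r \near r0, phi2 r < c.
  exact: (cvgr_lt (phi2 r0) (c2 r0)).
pose h := phi1 r0 \*: (id - cst r0) + (c / 2) \*: ((id - cst r0) * (id - cst r0)) - phi.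
have dh (r : R) : is_derive r 1 h (phi1 r0 + c * (r - r0) - phi1 r).
  have := d1 r => ?.
  by apply: is_derive_eq; rewrite !fctE /GRing.scale /=; lra.
have slope_le r s : r <= s -> ball r0 e r -> ball r0 e s ->
    phi1 s - phi1 r <= c * (s - r).
  move=> rs br bs; have [x /andP[rx xs] ->] := MVT_closed rs (fun x _ => d2 x).
  rewrite ler_wpM2r ?subr_ge0 // ltW //; apply: he.
  move: br bs; rewrite /ball /= !ltr_distlC => /andP[b1 b2] /andP[b3 b4].
  by apply/andP; split; lra.
have br0 : ball r0 e r0 by exact: ballxx.
have : \forall r \near r0, ball r0 e r by exact: nbhsx_ballx.
apply: filterS => r br.
have hr : h r0 <= h r.
  have [rr|/ltW rr] := leP r0 r.
    apply: (ge0_derive_le rr (fun x _ => dh x)) => x /andP[x1 x2].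
    have bx : ball r0 e x.
      move: br; rewrite /ball /= !ltr_distlC => /andP[b1 b2].
      by apply/andP; split; lra.
    have := slope_le _ _ x1 br0 bx; lra.
  rewrite -lerN2.
  have dn (x : R) : is_derive x 1 (- h) (- (phi1 r0 + c * (x - r0) - phi1 x)).
    by have := dh x => ?; exact: is_deriveN.
  apply: (ge0_derive_le rr (fun x _ => dn x)) => x /andP[x1 x2].
  have bx : ball r0 e x.
    move: br; rewrite /ball /= !ltr_distlC => /andP[b1 b2].
    by apply/andP; split; lra.
  have := slope_le _ _ x2 bx br0; lra.
have hE x : h x = phi1 r0 * (x - r0) + c / 2 * ((x - r0) * (x - r0)) - phi x by [].
by move: hr; rewrite !hE expr2 subrr !mulr0; lra.
Qed.

(** The radial function y |-> phi(|y - x0|) is touched from above at z by a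
quadratic polynomial in |y - x0|^2 whose infinity Laplacian there exceeds
phi'' by as little as one wants. This makes the barrier usable in the
definition of a viscosity subsolution, at its centre and elsewhere, without
differentiating it. *)
Lemma radial_touching (R : realType) n (x0 z : 'rV[R]_n)
    (phi phi1 phi2 : R -> R) (c : R) :
  let r0 := enorm (z - x0) in
  (forall r : R, is_derive r 1 phi (phi1 r)) ->
  (forall r : R, is_derive r 1 phi1 (phi2 r)) -> continuous phi2 ->
  phi2 r0 < c -> 0 < c -> phi1 0 = 0 -> (0 < r0 -> 0 < phi1 r0) ->
  exists P : 'rV[R]_n -> R, [/\ C2_near P z,
    P z = phi r0, \forall y \near z, phi (enorm (y - x0)) <= P y,
    enorm (grad P z) = phi1 r0 & inf_laplacian_plus P z <= c].
Proof.
move=> r0 d1 d2 c2 lt c0 phi10 phi1_gt0.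
have r00 : 0 <= r0 by exact: enorm_ge0.
pose s0 := r0 ^+ 2.
have zs : sqdist x0 z = s0 by rewrite /s0 sqr_enorm.
have dz : enorm (y - x0) @[y --> z] --> r0 by exact: dist_continuous.
have taylor (k : R) : phi2 r0 < k -> \forall y \near z,
    phi (enorm (y - x0)) <= phi r0 + phi1 r0 * (enorm (y - x0) - r0) +
       k / 2 * (enorm (y - x0) - r0) ^+ 2.
  move=> lk; have := taylor2_le d1 d2 c2 lk.
  by move=> /dz.
have [r0_gt0|] := ltP 0 r0; last first.
  move=> r0_le0; have r0E : r0 = 0 by apply/eqP; rewrite eq_le r0_le0.
  have zx : z = x0.
    by apply/subr0_eq/dotp_eq0; rewrite -sqr_enorm -/r0 r0E expr0n.
  have s00 : s0 = 0 by rewrite /s0 r0E expr0n.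
  exists (radial_quadratic x0 (phi r0) (c / 2) 0 s0); split.
  - exact: radial_quadratic_C2.
  - by rewrite /radial_quadratic zs subrr expr0n !mulr0 !addr0.
  - apply: filterS (taylor c lt) => y; rewrite r0E phi10 mul0r addr0 subr0.
    by rewrite /radial_quadratic s00 mul0r addr0 subr0 sqr_enorm.
  - by rewrite grad_radial_quadratic // enormZ -/r0 r0E mulr0 phi10.
  - rewrite zx; have c20 : 0 <= c / 2 by rewrite divr_ge0 // ltW.
    apply: le_trans; first exact: inf_laplacian_plus_radial_center.
    lra.
have p0 := phi1_gt0 r0_gt0.
(* D is chosen so that the infinity Laplacian is exactly c; the intermediate slope
   k leaves room for the error (r + r0)^2 - (2 r0)^2 near r0. *)
pose k := (phi2 r0 + c) / 2.
have lk : phi2 r0 < k by rewrite /k; lra.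
have kc : k < c by rewrite /k; lra.
pose B := phi1 r0 / (2 * r0).
pose D := (c - phi1 r0 / r0) / (8 * r0 ^+ 2).
have r0n : r0 != 0 by rewrite gt_eqF.
have B0 : 0 < B by rewrite divr_gt0 // mulr_gt0.
exists (radial_quadratic x0 (phi r0) B D s0); split.
- exact: radial_quadratic_C2.
- by rewrite /radial_quadratic zs subrr expr0n !mulr0 !addr0.
- have cD : (B + D * (enorm (y - x0) + r0) ^+ 2) @[y --> z] -->
      B + D * (r0 + r0) ^+ 2.
    have cpoly : continuous (fun r : R => B + D * (r + r0) ^+ 2).
      move=> r; apply: cvgD; first exact: cvg_cst.
      apply: cvgMr; apply: (@continuous_comp _ _ _ (fun r => r + r0) (fun r => r ^+ 2)).
        by apply: cvgD; [exact: cvg_id|exact: cvg_cst].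
      exact: exprn_continuous.
    by have := continuous_cvg _ (cpoly r0) dz; exact.
  have ltD : k / 2 < B + D * (r0 + r0) ^+ 2.
    have -> : B + D * (r0 + r0) ^+ 2 = c / 2 by rewrite /B /D; field.
    by rewrite ltr_pM2r.
  have near1 := cvgr_gt _ cD _ ltD.
  have near2 := taylor k lk.
  near=> y.
  have h1 : k / 2 < B + D * (enorm (y - x0) + r0) ^+ 2 by near: y; exact: near1.
  have h2 : phi (enorm (y - x0)) <= phi r0 + phi1 r0 * (enorm (y - x0) - r0) +
       k / 2 * (enorm (y - x0) - r0) ^+ 2 by near: y; exact: near2.
  apply: (le_trans h2); rewrite /radial_quadratic sqdistE.
  set r := enorm (y - x0) in h1 h2 *.
  have h3 : k / 2 * (r - r0) ^+ 2 <= (B + D * (r + r0) ^+ 2) * (r - r0) ^+ 2.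
    by rewrite ler_wpM2r ?sqr_ge0 // ltW.
  have E : B * (r ^+ 2 - s0) = phi1 r0 * (r - r0) + B * (r - r0) ^+ 2.
    by rewrite /B /s0; field.
  have E2 : D * (r ^+ 2 - s0) ^+ 2 = D * (r + r0) ^+ 2 * (r - r0) ^+ 2.
    by rewrite /s0; ring.
  rewrite E E2; move: h3; rewrite mulrDl.
  lra.
- have B2 : 0 <= 2 * B by rewrite mulr_ge0 // ltW.
  rewrite grad_radial_quadratic // enormZ -/r0 (ger0_norm B2).
  by rewrite /B; field.
- have s0_gt0 : 0 < s0 by rewrite exprn_gt0.
  apply: (@le_trans _ _ (2 * B + 8 * D * s0)).
    rewrite le_eqVlt; apply/orP; left; apply/eqP.
    exact: (inf_laplacian_plus_radial (phi r0) D zs s0_gt0 B0).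
  by rewrite le_eqVlt; apply/orP; left; apply/eqP; rewrite /B /D /s0; field.
Unshelve. all: by end_near. Qed.

(** * The estimate on the domain *)

Lemma is_derive_has_deriv_in (R : realType) (D : set R) (phi : R -> R)
    (x l : R) : is_derive x 1 phi l -> has_deriv_in D phi x l.
Proof.
case=> dphi <-; rewrite /has_deriv_in.
apply: (@cvg_trans _ ((phi y - phi x) / (y - x) @[y --> x^'])).
  exact/cvg_app/cvg_within.
apply/cvgrPdist_le => e e0.
have /cvgrPdist_le /(_ e e0) : h^-1 *: (phi (h *: 1 + x) - phi x) @[h --> 0^'] --> 'D_1 phi x.
  exact: dphi.
rewrite near_withinE => /nbhs_ballP[d /= d0 hd].
rewrite near_withinE; apply/nbhs_ballP; exists d => //= y xy yx.
have := hd (y - x); rewrite /ball /= sub0r normrN subr_eq0 distrC.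
rewrite /GRing.scale /= mulr1 subrK mulrC; apply; last exact: yx.
by move: xy; rewrite /ball.
Qed.

Lemma admissible_scale (R : realType) (f g : R -> R) (k : R) : 0 < k ->
  admissible f g -> admissible (fun t => k * f t) g.
Proof.
move=> k0 [[cf cg] [mf mg] fpos st gpos]; split => //.
- by split=> // t; apply: cvgMr; exact: cf.
- by split=> // x y xy; rewrite ler_wpM2l ?mf // ltW.
- move=> t t0; have [f1 f2] := fpos t t0.
  by rewrite pmulr_rgt0 // pmulr_rlt0.
- by case: st => st; [left|right] => // x y xy; rewrite ltr_pM2l ?st.
Qed.

Lemma sqrtF_powG_scale (R : realType) (q lam : R) (f g : R -> R) (s t : R) :
  continuous f -> 0 <= lam <= 1 ->
  lam * sqrtF_powG q f g s t <= sqrtF_powG q (fun x => lam ^+ 2 * f x) g s t.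
Proof.
move=> cf /andP[l0 l1]; rewrite /sqrtF_powG !primitive_scale // mulrDr.
apply: lerD; last by rewrite ler_piMl // powR_ge0.
by rewrite -mulrBr sqrtrM ?sqr_ge0 // sqrtr_sqr ger0_norm.
Qed.

(** The barrier solves the problem with lam^2 f in place of f. This makes it a
strict supersolution of the original equation, and weakens the bound on its
lifetime only by the factor 1 / lam. *)
Lemma profile_escape (R : realType) (q C lam a M : R) (f g : R -> R) :
  0 < q < 2 -> is_Cq q C -> admissible f g -> 0 < lam <= 1 -> 0 < a < M ->
  exists T (phi phi1 phi2 : R -> R),
    [/\ [/\ 0 < T, phi T = M, phi 0 = a & phi1 0 = 0],
      [/\ (forall r : R, is_derive r 1 phi (phi1 r)),
      (forall r : R, is_derive r 1 phi1 (phi2 r)) & continuous phi2],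
      forall r, 0 <= r <= T ->
        phi2 r = lam ^+ 2 * f (phi r) + g (phi r) * phi1 r `^ q,
      forall r, 0 < r -> 0 < phi1 r &
      ((C * lam * T)%:E <= escape_integral q f g a)%E].
Proof.
move=> hq [C0 hC] hfg /andP[l0 l1] /andP[a0 aM].
have l20 : 0 < lam ^+ 2 by rewrite exprn_gt0.
(* Scaling f by lam^2 keeps the pair admissible, so the constant C applies to it. *)
have hfg' := admissible_scale l20 hfg.
have [[cf _] _ fpos _ _] := hfg.
have fa : 0 < lam ^+ 2 * f a by rewrite mulr_gt0 //; case: (fpos a a0).
have aM' : 0 < a < M by rewrite a0.
have [T [phi [phi1 [phi2 [[T0 phiT] [phi0 phi10] [d1 d2] [c2 ode] lb]]]]] :=
  radial_profile hq hfg' aM'.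
have phi1_gt0 r : 0 < r -> 0 < phi1 r.
  by move=> r0; apply: lt_le_trans (lb _ (ltW r0)); rewrite mulr_gt0.
exists T, phi, phi1, phi2; split=> //.
apply: (lifetime_le_escape hq hfg a0 T0 d1).
- move=> r /andP[r0 _]; rewrite -phi0.
  have [c /andP[cr rc] E] := MVT_closed (ltW r0) (fun x _ => d1 x).
  pose m := r / 2; have m0 : 0 < m by rewrite divr_gt0.
  have mr : m <= r by rewrite /m; lra.
  have [c1 /andP[c10 _] E1] := MVT_closed (ltW m0) (fun x _ => d1 x).
  have [c3 /andP[c30 _] E2] := MVT_closed mr (fun x _ => d1 x).
  have p1 : 0 <= phi1 c1 by apply: le_trans (lb _ c10); rewrite mulr_ge0 // ltW.
  have p3 : 0 < phi1 c3 by apply: phi1_gt0; exact: lt_le_trans c30.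
  have : 0 <= phi m - phi 0 by rewrite E1 mulr_ge0 // subr0 ltW.
  have : 0 < phi r - phi m by rewrite E2 mulr_gt0 // /m; lra.
  lra.
- by move=> r /andP[/phi1_gt0/ltW].
- move=> r /andP[r0 rT].
  (* The profile lives beyond T, but it solves the equation up to T only. *)
  have sol : ivp_solution q (fun x => lam ^+ 2 * f x) g a T%:E phi phi1 phi2.
    split=> //.
    + by move=> x _; exact: is_derive_has_deriv_in.
    + by move=> x _; exact: is_derive_has_deriv_in.
    + exact: continuous_subspaceT.
    + move=> x [/= x0]; rewrite lte_fin => xT xp.
      by rewrite ode ?x0 ?(ltW xT) // ger0_norm // ltW // phi1_gt0.
  have := hC _ _ hfg' a T%:E phi phi1 phi2 a0 _ sol r r0.
  rewrite !lte_fin => /(_ T0 rT); apply: le_trans.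
  rewrite -mulrA ler_wpM2l ?(ltW C0) // sqrtF_powG_scale //.
  by rewrite (ltW l0).
Qed.

(** If Psi(a) < d(x), a radial barrier started at a reaches any prescribed
level, in particular one above u on a compact ball around x, before its radius
reaches d(x). If u(x) > a, then u minus the barrier has a positive interior
maximum, where the subsolution inequality contradicts the monotonicity of f
and g and the strictness of the barrier. *)
Lemma subsolution_le (R : realType) (n : nat) (Omega : set 'rV[R]_n)
    (q C a tau : R) (f g : R -> R) (u : 'rV[R]_n -> R) (x : 'rV[R]_n) :
  open Omega -> 0 < q < 2 -> is_Cq q C -> admissible f g ->
  viscosity_subsolution q f g Omega u -> Omega x -> 0 < a ->
  escape_integral q f g a = tau%:E -> tau < C * bdist Omega x -> u x <= a.
Proof.
move=> oO hq hC hfg [uscu sub] Ox a0 escE tau_lt.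
have [C0 _] := hC; have /andP[q0 q2] := hq.
have [[cf cg] [mf mg] fpos _ gpos] := hfg.
set d := bdist Omega x in tau_lt.
have tau0 : 0 <= tau by have := escape_ge0 q f g a; rewrite escE lee_fin.
have Cd0 : 0 < C * d by exact: le_lt_trans tau_lt.
have d0 : 0 < d by rewrite -(pmulr_rgt0 _ C0).
(* lam < 1 is such that a profile for lam^2 f still escapes within lam * d < d:
   the arithmetic mean of rho and 1 is greater than the square root of rho. *)
pose rho := tau / (C * d).
have rho1 : rho < 1 by rewrite ltr_pdivrMr // mul1r.
have rho0 : 0 <= rho by rewrite divr_ge0 // ltW.
pose lam := (1 + rho) / 2.
have l0 : 0 < lam by rewrite /lam; lra.
have l1 : lam < 1 by rewrite /lam; lra.
have lrho : rho < lam ^+ 2.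
  have : 0 < ((1 - rho) / 2) ^+ 2 by rewrite exprn_gt0 //; lra.
  by rewrite /lam !expr2; lra.
have tau_lam : tau < C * lam * (lam * d).
  have : tau < lam ^+ 2 * (C * d) by rewrite -ltr_pdivrMr.
  by rewrite expr2; lra.
rewrite leNgt; apply/negP => ua.
pose K r := [set y : 'rV[R]_n | enorm (y - x) <= r].
have Kx r : 0 <= r -> K r x.
  move=> r0; rewrite /K /= subrr /enorm /dotp big1 ?sqrtr0 // => i _.
  by rewrite mxE mul0r.
have KO r : r < d -> K r `<=` Omega.
  by move=> rd y yr; apply: (near_bdist_in oO Ox); exact: le_lt_trans rd.
have ld : lam * d < d by rewrite gtr_pMl.
have ld0 : 0 <= lam * d by rewrite mulr_ge0 // ltW.
have [zM _ HM] : exists2 z, K (lam * d) z & forall y, K (lam * d) y -> u y <= u z.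
  apply: usc_attains_max; [exact: closed_ball_compact|by exists x; exact: Kx|].
  by apply: usc_on_sub uscu; exact: KO.
(* The level M exceeds u on a ball that contains all balls considered below. *)
pose M := u zM + 1.
have aM : 0 < a < M.
  by rewrite a0 /M; have := HM _ (Kx _ ld0); lra.
have l01 : 0 < lam <= 1 by rewrite l0 ltW.
have [T [phi [phi1 [phi2 [[T0 phiT phi0 phi10] [d1 d2 c2] ode phi1_gt0 life]]]]] :=
  profile_escape hq hC hfg l01 aM.
have Tld : T < lam * d.
  move: life; rewrite escE lee_fin => /le_lt_trans /(_ tau_lam).
  by rewrite ltr_pM2l // mulr_gt0.
pose v y := phi (enorm (y - x)).
have cv : continuous v.
  move=> y; apply: (@continuous_comp _ _ _ (fun y : 'rV[R]_n => enorm (y - x)) phi).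
    exact: dist_continuous.
  exact: is_derive_continuous (d1 _).
have KTO : K T `<=` Omega by apply: KO; exact: lt_trans ld.
have [z Kz Hz] : exists2 z, K T z & forall y, K T y -> u y - v y <= u z - v z.
  apply: usc_attains_max; [exact: closed_ball_compact|by exists x; apply: Kx; exact: ltW|].
  by apply: usc_on_sub_continuous cv; apply: usc_on_sub uscu.
pose r0 := enorm (z - x).
have r00 : 0 <= r0 by exact: enorm_ge0.
have vx : v x = a.
  rewrite /v -phi0; congr phi; apply/eqP; rewrite eq_le enorm_ge0 andbT.
  exact: (Kx 0).
have uv : v z < u z.
  have := Hz x (Kx _ (ltW T0)); rewrite vx; lra.
have r0T : r0 < T.
  rewrite lt_neqAle Kz andbT; apply/eqP => r0E.
  have : u z <= u zM by apply: HM; apply: le_trans Kz _; exact: ltW.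
  by move: uv; rewrite /v -/r0 r0E phiT /M; lra.
have Oz : Omega z by exact: KTO.
have phi_ge r : 0 <= r -> a <= phi r.
  move=> r_ge0; rewrite -phi0; apply: (ge0_derive_le r_ge0 (fun x _ => d1 x)) => s /andP[s0 _].
  by move: s0; rewrite le_eqVlt => /predU1P[<-|/phi1_gt0/ltW //]; rewrite phi10.
have phir0 : 0 < phi r0 by apply: lt_le_trans (phi_ge _ r00).
have fp : 0 < f (phi r0) by case: (fpos _ phir0).
have phi1r0 : 0 <= phi1 r0.
  by move: r00; rewrite le_eqVlt => /predU1P[<-|/phi1_gt0/ltW //]; rewrite phi10.
pose L := f (phi r0) + g (phi r0) * phi1 r0 `^ q.
have odez : phi2 r0 = lam ^+ 2 * f (phi r0) + g (phi r0) * phi1 r0 `^ q.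
  by apply: ode; rewrite r00 ltW.
have l2 : lam ^+ 2 < 1 by rewrite expr_lt1 // ltW.
have gp : 0 <= g (phi r0) * phi1 r0 `^ q by rewrite mulr_ge0 ?powR_ge0 ?gpos.
have ltL : phi2 r0 < L by rewrite odez /L ltrD2r gtr_pMl.
have L0 : 0 < L by rewrite /L; lra.
(* c lies strictly between phi2 r0 and L and is positive; phi2 r0 < L is the
   gain from the factor lam^2. *)
pose c := Num.max ((phi2 r0 + L) / 2) (L / 2).
have cL : c < L by rewrite gt_max; apply/andP; split; lra.
have c0 : 0 < c by rewrite lt_max; apply/orP; right; lra.
have cphi : phi2 r0 < c by rewrite lt_max; apply/orP; left; lra.
have [P [C2P Pz vP gradP lapP]] :=
  @radial_touching R n x z phi phi1 phi2 c d1 d2 c2 cphi c0 phi10 (fun h => phi1_gt0 _ h).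
have touch : \forall y \near within Omega (nbhs z), u y - P y <= u z - P z.
  rewrite near_withinE.
  have nT : \forall y \near z, enorm (y - x) < T.
    by apply: (cvgr_lt r0 (@dist_continuous R n x z)).
  apply: filterS2 vP nT => y vPy yT _; rewrite Pz.
  have := Hz y (ltW yT); rewrite /v -/r0; lra.
have := sub z P Oz C2P touch; rewrite gradP -/r0 => key.
have : f (phi r0) + g (phi r0) * phi1 r0 `^ q <= f (u z) + g (u z) * phi1 r0 `^ q.
  have le : phi r0 <= u z by exact: ltW.
  by apply: lerD; [exact: mf|rewrite ler_wpM2r ?powR_ge0 // mg].
by rewrite -/L; lra.
Qed.

Theorem mainTheorem4 (R : realType) (n : nat) (Omega : set 'rV[R]_n)
    (q C mu : R) (f g : R -> R)
    (hOmega : open Omega) (hbd : boundary Omega !=set0)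
    (hq : 0 < q < 2) (hC : is_Cq q C)
    (hfg : admissible f g)
    (hint : (\int[lebesgue_measure]_(s in `[1%R, +oo[)
              ((Num.sqrt (primitive f s) + primitive g s `^ (2 - q)^-1)^-1)%:E
             < +oo)%E)
    (hlim : 1 < q ->
      (f t @[t --> +oo] --> +oo) \/ (g t @[t --> +oo] --> +oo))
    (hmu : 0 < mu < 1)
    (hh : forall s t, 0 < t -> t <= s -> mu * hfun q f g t <= hfun q f g s) :
  (Psi q C f g t @[t --> 0^'+] --> +oo%E) /\
  (forall u : 'rV[R]_n -> R, viscosity_subsolution q f g Omega u ->
    forall x, Omega x -> u x <= Phi q C f g (bdist Omega x)).
Proof.
have [C0 _] := hC; have /andP[mu0 _] := hmu.
have fin t : 0 < t -> (escape_integral q f g t < +oo)%E.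
  move=> t0; apply: (escape_finite hq hfg t0); apply: le_lt_trans hint.
  rewrite le_eqVlt; apply/orP; left; apply/eqP; apply: eq_integral => s _.
  by rewrite /sqrtF_powG !primitive0 !subr0.
have PsiE t : Psi q C f g t = (C^-1%:E * escape_integral q f g t)%E by [].
split.
  apply/cvgeyPge => A.
  apply: filterS (escape_at0 (C * A) hq hfg mu0 hh) => t At.
  have -> : (A%:E = C^-1%:E * (C * A)%:E)%E by rewrite -EFinM mulKf ?gt_eqF.
  by rewrite PsiE lee_wpmul2l // lee_fin invr_ge0 ltW.
move=> u subu x Ox; set d := bdist Omega x.
have d0 : 0 < d by exact: bdist_gt0.
have unb := coefficients_unbounded hq hfg (fin 1 ltr01) hlim.
have Cd0 : 0 < C * d by rewrite mulr_gt0.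
have [b b0 Eb] : exists2 b, 0 < b & escape_integral q f g b = (C * d)%:E.
  apply: (escape_surjective hq hfg fin (escape_to0 hq hfg (fin 1 ltr01) unb) _ Cd0).
  near (0 : R)^'+ => t; exists t; first by near: t; exact: nbhs_right_gt.
  near: t; exact: (escape_at0 (C * d) hq hfg mu0 hh).
pose S := [set t : R | 0 < t /\ Psi q C f g t = d%:E].
have [a0 Ea] : S (Phi q C f g d).
  apply: (@xgetPex _ 0 S); exists b; split => //.
  by rewrite PsiE Eb -EFinM mulrA mulVf ?gt_eqF // mul1r.
set a := Phi q C f g d in a0 Ea *.
have escape_a : escape_integral q f g a = (C * d)%:E.
  by rewrite EFinM -Ea PsiE muleA -EFinM mulfV ?gt_eqF // mul1e.
rewrite leNgt; apply/negP => au.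
(* By strict monotonicity, a level a' slightly above a escapes before d. *)
pose a' := (a + u x) / 2.
have aa' : a < a' by rewrite /a'; lra.
have a'u : a' < u x by rewrite /a'; lra.
have a'0 : 0 < a' by exact: lt_trans aa'.
have := escape_lt hq hfg a0 aa' (fin a a0); rewrite escape_a.
move: (escape_ge0 q f g a'); case E : (escape_integral q f g a') => [tau| |] // _.
rewrite lte_fin => tau_lt.
have := subsolution_le hOmega hq hC hfg subu Ox a'0 E tau_lt.
by rewrite leNgt a'u.
Unshelve. all: by end_near. Qed.
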